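(* Let $(X,d)$ be a separable (possibly extended) metric space with the topology induced by $d$. Then the Hellinger-Kantorovich distance $\mathsf{HK}$ induces the weak (narrow) topology on $\mathcal M(X)$: a sequence $(\mu_n)_{n\in\mathbb N}$ in $\mathcal M(X)$ converges to $\mu\in\mathcal M(X)$ in $(\mathcal M(X),\mathsf{HK})$ if and only if $(\mu_n)$ converges weakly to $\mu$ in duality with continuous and bounded functions, i.e. $\int\varphi\,d\mu_n\to\int\varphi\,d\mu$ for every $\varphi\in C_b(X)$. In particular, the metric space $(\mathcal M(X),\mathsf{HK})$ is separable.
   Context: $\mathcal M(X)$ is the set of finite nonnegative Radon measures on $X$. Cone: $\mathfrak C$ is the quotient of $X\times[0,\infty)$ obtained by identifying all points $(x,0)$ with a single point $\mathfrak o$; classes are $[x,r]$. With $d_\pi=\min(d,\pi)$, $d_{\mathfrak C}^2([x_1,r_1],[x_2,r_2])=r_1^2+r_2^2-2r_1r_2\cos(d_\pi(x_1,x_2))$; $\mathfrak C$ carries the topology of the distance $d_{\mathfrak C}$. Put $\mathsf r([x,r])=r$, $\mathsf x([x,r])=x$ if $r>0$, $\mathsf x(\mathfrak o)=\bar x$ for a fixed arbitrary $\bar x\in X$; on $\mathfrak C\times\mathfrak C$, $\mathsf x_i,\mathsf r_i$ denote $\mathsf x,\mathsf r$ of the $i$-th component. For $\alpha\in\mathcal M(\mathfrak C\times\mathfrak C)$ with $\int(\mathsf r_1^2+\mathsf r_2^2)\,d\alpha<\infty$ ($\alpha\in\mathcal M_2(\mathfrak C\times\mathfrak C)$) set $\mathfrak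 h_i\alpha=(\mathsf x_i)_\sharp(\mathsf r_i^2\alpha)\in\mathcal M(X)$. The Hellinger-Kantorovich distance is $$\mathsf{HK}^2(\mu_1,\mu_2)=\min\Big\{\int d_{\mathfrak C}^2\,d\alpha:\ \alpha\in\mathcal M_2(\mathfrak C\times\mathfrak C),\ \mathfrak h_i\alpha=\mu_i,\ i=1,2\Big\}.$$ *)

(* Defs.v *)
From HB Require Import structures.
From mathcomp Require Import all_boot all_order all_algebra.
From mathcomp Require Import all_classical all_reals all_analysis.

Set Implicit Arguments.
Unset Strict Implicit.
Unset Printing Implicit Defensive.

Import Order.TTheory GRing.Theory Num.Theory.
Import numFieldNormedType.Exports.

Local Open Scope classical_set_scope.
Local Open Scope ring_scope.
Local Open Scope quotient_scope.

Record extended_metric (R : realType) (T : Type) (d : T -> T -> \bar R) : Prop :=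
  ExtendedMetric {
  extended_metric_ge0 : forall x y, (0 <= d x y)%E ;
  extended_metric_eq0 : forall x y, d x y = 0%E <-> x = y ;
  extended_metric_sym : forall x y, d x y = d y x ;
  extended_metric_triangle : forall x y z, (d x z <= d x y + d y z)%E }.

(* The type [T] with the topology induced by [d]: a set is open when it
   contains a [d]-ball of positive real radius around each of its points.
   This is a topology for an arbitrary function [d], so that no metric axiom is
   needed to form the space. *)
Definition dspace (R : realType) (T : Type) (d : T -> T -> \bar R) : Type := T.

Section dspace_topology.
Context (R : realType) (T : choiceType) (d : T -> T -> \bar R).

Definition dspace_open (A : set T) :=
  forall x, A x -> exists2 e : R, 0 < e & [set y | (d x y < e%:E)%E] `<=` A.

Let dspace_openT : dspace_open setT.
Proof. by move=> x _; exists 1. Qed.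

Let dspace_openI : setI_closed dspace_open.
Proof.
move=> A B oA oB x [/oA[e e0 eA] /oB[f f0 fB]].
exists (Order.min e f); first by rewrite lt_min e0 f0.
move=> y /=; rewrite EFin_min lt_min => /andP[xye xyf].
by split; [exact: eA | exact: fB].
Qed.

Let dspace_open_bigU (I : Type) (f : I -> set T) :
  (forall i, dspace_open (f i)) -> dspace_open (\bigcup_i f i).
Proof.
move=> of_ x [i _ /of_[e e0 ef]]; exists e => // y /ef fy.
by exists i.
Qed.

HB.instance Definition _ := Choice.on (dspace d).
HB.instance Definition _ := isOpenTopological.Build (dspace d)
  dspace_openT dspace_openI dspace_open_bigU.

End dspace_topology.

HB.instance Definition _ (R : realType) (T : pointedType) (d : T -> T -> \bar R) :=
  Pointed.on (dspace d).

(* The library has the pointed and the topological structure of a product, but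
   not their join. *)
HB.instance Definition _ (T U : ptopologicalType) := Pointed.on (T * U)%type.

Definition separable_space (T : topologicalType) :=
  exists2 S : set T, countable S & dense S.

Definition borel (T : ptopologicalType) := g_sigma_algebraType (@open T).

(* [measurable K] is automatic in Hausdorff spaces, where compact sets are
   closed. *)
Record radon_measure (R : realType) (T : ptopologicalType) := RadonMeasure {
  radon_val :> {finite_measure set (borel T) -> \bar R} ;
  radon_val_regular : forall B : set (borel T), measurable B ->
    forall e : R, 0 < e -> exists K : set (borel T),
      [/\ @compact T K, measurable K, K `<=` B &
          (radon_val (B `\` K) <= e%:E)%E] }.

HB.instance Definition _ (R : realType) (T : ptopologicalType) :=
  gen_eqMixin (radon_measure R T).
HB.instance Definition _ (R : realType) (T : ptopologicalType) :=
  gen_choiceMixin (radon_measure R T).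

Section cone.
Context (R : realType) (X : pointedType).

Definition cone_eq (p q : X * {nonneg R}) : bool :=
  (p == q) || ((p.2%:num == 0) && (q.2%:num == 0)).

Lemma cone_eq_refl : reflexive cone_eq.
Proof. by move=> p; rewrite /cone_eq eqxx. Qed.

Lemma cone_eq_sym : symmetric cone_eq.
Proof. by move=> p q; rewrite /cone_eq eq_sym andbC. Qed.

Lemma cone_eq_trans : transitive cone_eq.
Proof.
move=> q p r /orP[/eqP->//|/andP[p0 q0]] /orP[/eqP<-|/andP[_ r0]].
  by rewrite /cone_eq p0 q0 orbT.
by rewrite /cone_eq p0 r0 orbT.
Qed.

Canonical cone_equiv :=
  EquivRel cone_eq cone_eq_refl cone_eq_sym cone_eq_trans.

Definition cone := {eq_quot cone_equiv}.

HB.instance Definition _ := Choice.on cone.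
HB.instance Definition _ := EqQuotient.on cone.

Definition cone_pt (x : X) (r : {nonneg R}) : cone := \pi_cone (x, r).

HB.instance Definition _ := isPointed.Build cone (cone_pt point 0%:nng).

Definition cone_r (p : cone) : R := (repr p).2%:num.

(* [point] plays the role of the arbitrary point of [X] that is the image of
   the vertex. *)
Definition cone_x (p : cone) : X :=
  if 0 < cone_r p then (repr p).1 else point.

Lemma cone_rE x r : cone_r (cone_pt x r) = r%:num.
Proof.
rewrite /cone_r /cone_pt; case: piP => q.
by move/eqmodP; rewrite /= /cone_eq => /orP[/eqP<-//|/andP[/eqP/= -> /eqP ->]].
Qed.

Lemma cone_xE x r : cone_x (cone_pt x r) = if 0 < r%:num then x else point.
Proof.
rewrite /cone_x cone_rE; case: ifPn => // r0.
rewrite /cone_pt; case: piP => q.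
move/eqmodP; rewrite /= /cone_eq => /orP[/eqP<-//|/andP[/eqP/= r0' _]].
by rewrite r0' ltxx in r0.
Qed.

Context (d : X -> X -> \bar R).

Definition dist_pi (x y : X) : R := fine (Order.min (d x y) (pi%:E)%E).

(* At the vertex the term [dist_pi] is multiplied by [0], hence the choice of
   [cone_x] there does not matter: see [cone_distE]. *)
Definition cone_dist (p q : cone) : R :=
  Num.sqrt (cone_r p ^+ 2 + cone_r q ^+ 2
    - 2 * cone_r p * cone_r q * cos (dist_pi (cone_x p) (cone_x q))).

Lemma cone_distE x r y s : cone_dist (cone_pt x r) (cone_pt y s) =
  Num.sqrt (r%:num ^+ 2 + s%:num ^+ 2
    - 2 * r%:num * s%:num * cos (dist_pi x y)).
Proof.
rewrite /cone_dist !cone_rE !cone_xE.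
have [r0|] := ltP 0 r%:num; last first.
  by rewrite le_eqVlt ltNge ge0 orbF => /eqP ->; rewrite mulr0 !mul0r.
have [//|] := ltP 0 s%:num.
by rewrite le_eqVlt ltNge ge0 orbF => /eqP ->; rewrite mulr0 !mul0r.
Qed.

Definition cone_space : ptopologicalType :=
  dspace (fun p q : cone => (cone_dist p q)%:E).

End cone.

Section hellinger_kantorovich.
Context (R : realType) (X : pointedType) (d : X -> X -> \bar R).

Local Notation M := (radon_measure R (dspace d)).
Local Notation CC := (cone_space d * cone_space d)%type.

(* [hmarginal fst] and [hmarginal snd] are the two homogeneous marginals. *)
Definition hmarginal (pr : CC -> cone R X) (alpha : radon_measure R CC) :
    set (borel (dspace d)) -> \bar R :=
  pushforward (fun A : set (borel CC) =>
      (\int[alpha]_(p in A) (cone_r (pr p) ^+ 2)%:E)%E)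
    (fun p : borel CC => cone_x (pr p) : borel (dspace d)).

Definition HK_plans (mu1 mu2 : M) : set (radon_measure R CC) :=
  [set alpha : radon_measure R CC | [/\
    (\int[alpha]_p (cone_r p.1 ^+ 2 + cone_r p.2 ^+ 2)%:E < +oo)%E,
    forall B, measurable B -> hmarginal fst alpha B = mu1 B &
    forall B, measurable B -> hmarginal snd alpha B = mu2 B]].

Definition HK_cost (alpha : radon_measure R CC) : \bar R :=
  (\int[alpha]_p (cone_dist d p.1 p.2 ^+ 2)%:E)%E.

Definition HK (mu1 mu2 : M) : \bar R :=
  sqrte (ereal_inf (HK_cost @` HK_plans mu1 mu2)).

Definition Cb := {phi : dspace d -> R | continuous phi /\ bounded_fun phi}.

(* The coarsest topology for which [mu |-> \int phi dmu] is continuous for every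
   bounded continuous [phi]. *)
Definition narrow_space := initial_topology
  (fun mu : M => (fun phi => \int[mu]_x sval phi x) : {ptws Cb -> R}).

Definition HK_open : set (set M) := @open (dspace HK).

Definition narrow_open : set (set M) := @open narrow_space.

End hellinger_kantorovich.
Arguments HK {R X} d mu1 mu2.
Arguments HK_open {R X} d.
Arguments narrow_open {R X} d.

(* Main.v *)
Require Import Defs.
From HB Require Import structures.
From mathcomp Require Import all_boot all_order all_algebra.
From mathcomp Require Import all_classical all_reals all_analysis.
From mathcomp Require Import measurable_realfun ring lra.

Set Implicit Arguments.
Unset Strict Implicit.
Unset Printing Implicit Defensive.

Import Order.TTheory GRing.Theory Num.Theory.
Import numFieldNormedType.Exports.

Local Open Scope classical_set_scope.
Local Open Scope ring_scope.

(** A set is open for [HK], respectively for the narrow topology, when it contains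
an [HK]-ball, respectively a narrow neighbourhood, of each of its points. Hence
it suffices to compare the neighbourhoods of a measure [mu], that is, to bound
the cost of the plans between [mu] and another measure [nu] from below and from
above.

- Small cost forces narrow closeness. For a plan [alpha] between [mu] and [nu],
  the difference of the integrals of a test function [phi] is the integral
  against [alpha] of [phi x1 * r1 ^+ 2 - phi x2 * r2 ^+ 2]. Radii are
  1-Lipschitz on the cone, and an angle of at least [t] between two points
  forces [r1 * sin t <= cone_dist]; below that angle [phi] hardly varies as long
  as [x1] stays in a compact set [K] that carries almost all of [mu]. Hence the
  integrand is at most a constant times the squared cone distance, plus a small
  multiple of [r1 ^+ 2], plus a multiple of [r1 ^+ 2] where [x1] is outside [K]
  ([cone_test_estimate]). After integration only the cost and the first
  marginal [mu] are left ([plan_test_estimate], [narrow_near]).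

- Narrow closeness forces small cost. A finite partition of unity by continuous
  functions, all but one supported in small balls, cuts [mu] and [nu] into
  pieces. Two pieces of masses [m] and [n] carried by the same small ball are
  matched by their product, lifted to the cone at constant radii; this costs at
  most [`|m - n| + k * (m + n)] with [k] small ([plan_local]). The remaining
  function has a small integral against [mu], so that there the crude value
  [k = 2] suffices. The masses of the pieces are integrals of finitely many
  bounded continuous functions, hence a narrow neighbourhood controls the total
  ([plan_partition], [HK_near]).

- Separability. In the same construction, replace the pieces of [nu] by
  rational multiples of Dirac masses at points of a dense sequence
  ([plan_discrete], [HK_separable]).

[narrow_near] and [HK_near] are stated for a filter of measures: the filter of
narrow neighbourhoods and the filter of [HK]-balls yield the equality of the
topologies, the image of the filter at infinity yields the statement on
sequences.

The plans have to be Radon measures on the square of the cone. They are images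
under continuous maps of products of Radon measures. Such a product is a Borel
measure because the separability of [X] makes the Borel sets of [X * X] belong
to the product sigma-algebra ([open_prod_measurable]), and it is Radon because
inner regularity passes from rectangles to the sigma-algebra that they generate
([inner_regular_generated]). *)

(** * Borel sets and Radon measures *)

Lemma open_borel (T : ptopologicalType) (A : set (borel T)) :
  @open T A -> measurable A.
Proof. by move=> oA; apply: sub_sigma_algebra. Qed.

Lemma closed_borel (T : ptopologicalType) (A : set (borel T)) :
  @closed T A -> measurable A.
Proof.
move=> cA; rewrite -(setCK A); apply: measurableC.
by apply: open_borel; exact: closed_openC.
Qed.

Lemma compact_borel (T : ptopologicalType) (A : set (borel T)) :
  hausdorff_space T -> @compact T A -> measurable A.
Proof. by move=> hT cA; apply: closed_borel; exact: compact_closed. Qed.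

Lemma continuous_borel (T U : ptopologicalType) (f : T -> U) :
  continuous f -> measurable_fun [set: borel T] (f : borel T -> borel U).
Proof.
move=> cf; apply: (@measurability _ _ (borel T) (borel U) _ _ (@open U)) => //.
move=> _ [B oB <-]; rewrite setTI; apply: open_borel.
by move/continuousP : cf; exact.
Qed.

Lemma measure_le_geometric_cover (R : realType) d (T : measurableType d)
    (m : {measure set T -> \bar R}) (D : set T) (F : nat -> set T) (e : R) :
  0 <= e -> measurable D -> (forall n, measurable (F n)) ->
  D `<=` \bigcup_n F n ->
  (forall n, (m (F n) <= (e / (2 ^ n.+1)%:R)%:E)%E) -> (m D <= e%:E)%E.
Proof.
move=> e0 mD mF DF Fe.
apply: (le_trans (measure_sigma_subadditive m mF mD DF)).
apply: le_trans (epsilon_trick0 xpredT e0).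
by apply: lee_nneseries => // n _.
Qed.

Section inner_regular.
Context (R : realType) (T : ptopologicalType).

(** The measurability of [K] is left out: it is automatic in a Hausdorff space,
and the sets [K] are obtained below by limit operations. *)
Definition inner_regular (m : set (borel T) -> \bar R) (B : set T) :=
  forall e : R, 0 < e -> exists K : set T,
    [/\ compact K, K `<=` B & (m (B `\` K) <= e%:E)%E].

Lemma radon_measureP (m : {finite_measure set (borel T) -> \bar R}) :
  hausdorff_space T ->
  (forall B : set (borel T), measurable B -> inner_regular m B) ->
  exists mu : radon_measure R T, forall B, mu B = m B.
Proof.
move=> hT mreg.
have reg : forall B : set (borel T), measurable B ->
    forall e : R, 0 < e -> exists K : set (borel T),
      [/\ @compact T K, measurable K, K `<=` B & (m (B `\` K) <= e%:E)%E].
  move=> B mB e e0; have [K [cK KB mK]] := mreg B mB e e0.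
  by exists K; split => //; exact: compact_borel.
by exists (RadonMeasure reg).
Qed.

Lemma radon_inner_regular (mu : radon_measure R T) (B : set (borel T)) :
  measurable B -> inner_regular mu B.
Proof.
by move=> mB e e0; have [K [? ? ? ?]] := radon_val_regular mu mB e0; exists K.
Qed.

Section countable.
Variables (m : {finite_measure set (borel T) -> \bar R}).
Variable F : nat -> set (borel T).
Hypothesis hT : hausdorff_space T.
Hypothesis mF : forall n, measurable (F n).

Let eps (e : R) (n : nat) := e / (2 ^ n.+1)%:R.

Let eps_gt0 e n : 0 < e -> 0 < eps e n.
Proof. by move=> e0; rewrite divr_gt0// ltr0n expn_gt0. Qed.

Hypothesis regF : forall n, inner_regular m (F n).

Let pickK (e : R) : 0 < e -> exists K : nat -> set T, forall n,
  [/\ compact (K n), K n `<=` F n & (m (F n `\` K n) <= (eps e n)%:E)%E].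
Proof.
move=> e0; have /choice[K HK] : forall n, exists K : set T,
   [/\ compact K, K `<=` F n & (m (F n `\` K) <= (eps e n)%:E)%E].
  by move=> n; apply: regF; exact: eps_gt0.
by exists K.
Qed.

(** Losing [e / 2 ^ n.+1] in the [n]-th set, the intersection of the compact
sets loses at most [e]. *)
Lemma inner_regular_bigcap : inner_regular m (\bigcap_n F n).
Proof.
move=> e e0; have [K HK] := pickK e0.
have cK n : compact (K n) by have [] := HK n.
exists (\bigcap_n K n); split.
- rewrite [X in compact X](_ : _ = K 0%N `&` \bigcap_n K n); last first.
    by apply/seteqP; split=> [x Kx|x []//]; split => //; exact: Kx.
  apply: compact_closedI => //; apply: closed_bigI => n _.
  exact: compact_closed.
- by move=> x Kx n _; have [_ + _] := HK n; apply; exact: Kx.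
apply: (measure_le_geometric_cover (F := fun n => F n `\` K n)); rewrite ?ltW//.
- apply: measurableD; first exact: bigcapT_measurable.
  by apply: bigcapT_measurable => n; exact: compact_borel.
- by move=> n; apply: measurableD => //; exact: compact_borel.
- move=> x [Fx /existsNP[n /not_implyP[_ nK]]].
  by exists n => //; split => //; exact: Fx.
- by move=> n; have [] := HK n.
Qed.

(** The union of all the compact sets is not compact, but by continuity from
above its finite subunions exhaust the measure. *)
Lemma inner_regular_bigcup : inner_regular m (\bigcup_n F n).
Proof.
move=> e e0; have e20 : 0 < e / 2 by rewrite divr_gt0.
have [K HK] := pickK e20.
have mK n : (measurable : set (set (borel T))) (K n).
  by apply: compact_borel => //; have [] := HK n.
pose L N := \big[setU/set0]_(i < N) K i.
pose D N : set (borel T) := \bigcup_n F n `\` L N.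
have mD N : measurable (D N).
  apply: measurableD; first exact: bigcupT_measurable.
  by apply: bigsetU_measurable => i _; exact: mK.
have : (m (\bigcap_N D N) <= (e / 2)%:E)%E.
  apply: (measure_le_geometric_cover (F := fun n => F n `\` K n)); rewrite ?ltW//.
  - exact: bigcapT_measurable.
  - by move=> n; apply: measurableD.
  - move=> x Dx; have [[n _ Fnx] _] := Dx 0%N I.
    exists n => //; split => // Knx; have [_] := Dx n.+1 I; apply.
    by rewrite /L big_ord_recr/=; right.
  - by move=> n; have [] := HK n.
move=> Doo.
have cD : m (D n) @[n --> \oo] --> m (\bigcap_N D N).
  apply: nonincreasing_cvg_mu => //.
  - by rewrite ltey_eq fin_num_measure.
  - exact: bigcapT_measurable.
  - move=> a b ab; apply/subsetPset => x [Fx nL]; split => //.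
    by move=> Lx; apply: nL; exact: (@subset_bigsetU _ K a b ab x Lx).
have Doo' : (m (\bigcap_N D N) < e%:E)%E.
  by apply: le_lt_trans Doo _; rewrite lte_fin; lra.
have [N _ HN] : \forall n \near \oo, (m (D n) < e%:E)%E.
  apply: (cD [set y | (y < e%:E)%E]); apply: open_nbhs_nbhs.
  by split; [exact: open_ereal_lt_ereal|].
exists (L N); split.
- by apply: bigsetU_compact => i _; have [] := HK i.
- apply: subset_trans (@bigsetU_bigcup _ K N) _.
  by apply: subset_bigcup => n _; have [] := HK n.
- exact: ltW (HN N (leqnn N)).
Qed.

End countable.

(** Inner regularity alone is not stable under complement, but the measurable
sets that are inner regular together with their complement form a
sigma-algebra. *)
Lemma inner_regular_generated (m : {finite_measure set (borel T) -> \bar R})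
    (G : set (set T)) :
  hausdorff_space T -> inner_regular m setT ->
  (forall A : set T, G A -> [/\ (measurable : set (set (borel T))) A,
     inner_regular m A & inner_regular m (~` A)]) ->
  forall B, <<s G >> B -> inner_regular m B.
Proof.
move=> hT regT GP B GB.
pose H := [set A : set T | [/\ (measurable : set (set (borel T))) A,
     inner_regular m A & inner_regular m (~` A)]].
suff : H B by case.
apply: (smallest_sub _ _ GB) => //; split.
- split; first exact: (@measurable0 _ (borel T)).
  + move=> e e0; exists set0; split => //; first exact: compact0.
    by rewrite setD0 measure0 lee_fin ltW.
  + by rewrite setC0.
- move=> A [mA rA rAC]; rewrite setTD; split => //.
    exact: (@measurableC _ (borel T)).
  by rewrite setCK.
- move=> F HF; split.
  + by apply: (@bigcupT_measurable _ (borel T)) => n; have [] := HF n.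
  + by apply: inner_regular_bigcup => // n; have [] := HF n.
  + rewrite setC_bigcup; apply: inner_regular_bigcap => // n; last first.
      by have [] := HF n.
    by apply: (@measurableC _ (borel T)); have [] := HF n.
Qed.

End inner_regular.

Section finite_of_measure.
Context (R : realType) d (T : measurableType d).
Context (m : {measure set T -> \bar R}) (m_fin : fin_num_fun m).

(** A copy of [m] that carries the structure of a finite measure; the proof of
finiteness is an argument so that the structure can be attached to it. *)
Definition finite_of_measure (_ : fin_num_fun m) : set T -> \bar R := m.

HB.instance Definition _ := Measure.on (finite_of_measure m_fin).
HB.instance Definition _ :=
  Measure_isFinite.Build d T R (finite_of_measure m_fin) m_fin.

End finite_of_measure.

Lemma ex_finite_measure (R : realType) d (T : measurableType d)
    (m : {measure set T -> \bar R}) : (m setT < +oo)%E ->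
  exists m' : {finite_measure set T -> \bar R}, forall A, m' A = m A.
Proof.
move=> mT.
have fm : fin_num_fun m.
  move=> U mU; rewrite ge0_fin_numE//; apply: le_lt_trans mT.
  by apply: le_measure; rewrite ?inE.
by exists (finite_of_measure fm).
Qed.

Lemma ex_finite_pushforward (R : realType) d d' (T : measurableType d)
    (U : measurableType d') (f : T -> U) (m : {finite_measure set T -> \bar R}) :
  measurable_fun setT f ->
  exists m' : {finite_measure set U -> \bar R},
    forall A, m' A = pushforward m f A.
Proof.
move=> mf.
unshelve refine (ex_finite_measure
  (m := pushforward m f : {measure set U -> \bar R}) _) => //.
by rewrite /= /pushforward preimage_setT ltey_eq fin_num_measure.
Qed.

Section constructions.
Context (R : realType).

Lemma radon_push (T U : ptopologicalType) (f : T -> U)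
    (mu : radon_measure R T) :
  hausdorff_space U -> continuous f ->
  exists nu : radon_measure R U,
    forall B : set (borel U), nu B = pushforward mu (f : borel T -> borel U) B.
Proof.
move=> hU cf; have mf := continuous_borel cf.
have [m' m'E] := ex_finite_pushforward mu mf.
suff reg (B : set (borel U)) : measurable B -> inner_regular m' B.
  have [nu nuE] := radon_measureP hU reg.
  by exists nu => B; rewrite nuE m'E.
move=> mB e e0.
have mfB : measurable (f @^-1` B : set (borel T)).
  by rewrite -[X in measurable X]setTI; exact: mf.
have [K [cK bK KB mK]] := radon_val_regular mu mfB e0.
have cfK : compact (f @` K).
  by apply: continuous_compact => //; exact: continuous_subspaceT.
exists (f @` K); split => //.
  by move=> _ [x Kx <-]; exact: KB.
rewrite m'E /pushforward; apply: le_trans mK; apply: le_measure.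
- rewrite inE; apply: (@measurableD _ (borel T) (f @^-1` B)) => //.
  rewrite -[X in measurable X]setTI.
  exact: (mf measurableT _ (compact_borel hU cfK)).
- by rewrite inE; exact: measurableD.
- by apply: setDS; exact: preimage_image.
Qed.

Lemma radon_add (T : ptopologicalType) (mu nu : radon_measure R T) :
  hausdorff_space T ->
  exists rho : radon_measure R T, forall B, (rho B = mu B + nu B)%E.
Proof.
move=> hT.
have addE B : measure_add mu nu B = (mu B + nu B)%E by exact: measure_addE.
have [|m' m'E] := @ex_finite_measure R _ _ (measure_add mu nu).
  by rewrite [X in (X < _)%E](addE setT) lte_add_pinfty// ltey_eq fin_num_measure.
have m'D B : m' B = (mu B + nu B)%E by rewrite m'E; exact: addE.
suff reg (B : set (borel T)) : measurable B -> inner_regular m' B.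
  have [rho rhoE] := radon_measureP hT reg.
  by exists rho => B; rewrite rhoE m'D.
move=> mB e e0.
have e20 : 0 < e / 2 by rewrite divr_gt0.
have [K [cK KB mK]] := radon_inner_regular mu mB e20.
have [L [cL LB nL]] := radon_inner_regular nu mB e20.
exists (K `|` L); split; first exact: compactU.
  by rewrite subUset.
rewrite m'D [e in leRHS](splitr e) EFinD; apply: leeD.
- apply: le_trans mK; apply: le_measure; rewrite ?inE; try apply: measurableD => //.
  + by apply: compact_borel => //; exact: compactU.
  + exact: compact_borel.
  + by apply: setDS; exact: subsetUl.
- apply: le_trans nL; apply: le_measure; rewrite ?inE; try apply: measurableD => //.
  + by apply: compact_borel => //; exact: compactU.
  + exact: compact_borel.
  + by apply: setDS; exact: subsetUr.
Qed.

Lemma radon_dirac (T : ptopologicalType) (r : {nonneg R}) (x : T) :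
  hausdorff_space T ->
  exists rho : radon_measure R T,
    forall B : set (borel T), (rho B = r%:num%:E * \d_(x : borel T) B)%E.
Proof.
move=> hT.
have dE (B : set (borel T)) :
    mscale r (\d_(x : borel T) : {measure set (borel T) -> \bar R}) B =
    (r%:num%:E * \d_(x : borel T) B)%E by [].
have [|m' m'E] := @ex_finite_measure R _ _
    (mscale r (\d_(x : borel T) : {measure set (borel T) -> \bar R})).
  by rewrite [X in (X < _)%E](dE setT) diracT mule1 ltry.
have {}m'E B : m' B = (r%:num%:E * \d_(x : borel T) B)%E by rewrite m'E.
suff reg (B : set (borel T)) : measurable B -> inner_regular m' B.
  have [rho rhoE] := radon_measureP hT reg.
  by exists rho => B; rewrite rhoE m'E.
move=> mB e e0.
exists (B `&` [set x]); split.
- have [xB|xB] := pselect (B x).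
    rewrite (_ : B `&` _ = [set x]); first exact: compact_set1.
    by apply/seteqP; split=> [y []//|y ->].
  rewrite (_ : B `&` _ = set0); first exact: compact0.
  by apply/seteqP; split=> [y [By yx]|//]; rewrite yx in By.
- by move=> y [].
- rewrite m'E diracE memNset ?mule0 ?lee_fin ?ltW//.
  by move=> [Bx]; apply.
Qed.

Lemma radon_density (T : ptopologicalType) (mu : radon_measure R T)
    (f : T -> R) : hausdorff_space T ->
  measurable_fun [set: borel T] (f : borel T -> R) ->
  (forall x, 0 <= f x <= 1) ->
  exists rho : radon_measure R T,
    forall B : set (borel T), (rho B = \int[mu]_(x in B) (f x)%:E)%E.
Proof.
move=> hT mf f01.
have f0 x : 0 <= f x by have /andP[] := f01 x.
pose m := fun B : set (borel T) => (\int[mu]_(x in B) (f x)%:E)%E.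
pose Ef : borel T -> \bar R := fun x => (f x)%:E.
have mEf : measurable_fun [set: borel T] Ef by exact/measurable_EFinP.
have m0 : m set0 = 0%E by rewrite /m integral_set0.
have m_ge0 B : (0 <= m B)%E.
  by apply: integral_ge0 => x _; rewrite lee_fin.
have m_add : semi_sigma_additive m.
  by apply: (semi_sigma_additive_nng_induced (f := Ef)).
pose mm : {measure set (borel T) -> \bar R} :=
  HB.pack m (isMeasure.Build _ _ _ m m0 m_ge0 m_add).
have mmu (B : set (borel T)) : measurable B -> (mm B <= mu B)%E.
  move=> mB; rewrite -[leRHS]mul1e -integral_cst//.
  apply: ge0_le_integral => //.
  - by move=> x _; rewrite lee_fin.
  - exact: measurable_funTS.
  - by move=> x _; rewrite lee_fin; have /andP[] := f01 x.
have [|m' m'E] := @ex_finite_measure R _ _ mm.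
  by apply: (le_lt_trans (mmu _ measurableT)); rewrite ltey_eq fin_num_measure.
suff reg (B : set (borel T)) : measurable B -> inner_regular m' B.
  have [rho rhoE] := radon_measureP hT reg.
  by exists rho => B; rewrite rhoE m'E.
move=> mB e e0.
have [K [cK KB mK]] := radon_inner_regular mu mB e0.
exists K; split => //; rewrite m'E; apply: le_trans mK; apply: mmu.
by apply: measurableD => //; exact: compact_borel.
Qed.

End constructions.

(** * Products of Radon measures *)

Lemma hausdorff_prod (T U : topologicalType) :
  hausdorff_space T -> hausdorff_space U -> hausdorff_space (T * U)%type.
Proof.
move=> hT hU [a b] [c d] cl; congr pair.
- apply: hT => A C nA nC.
  have [[x y] [/= Ax Cx]] : (fst @^-1` A `&` fst @^-1` C : set (T * U)) !=set0.
    by apply: cl; apply: (@cvg_fst _ _ (nbhs _) (nbhs _)).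
  by exists x.
- apply: hU => A C nA nC.
  have [[x y] [/= Ay Cy]] : (snd @^-1` A `&` snd @^-1` C : set (T * U)) !=set0.
    by apply: cl; apply: (@cvg_snd _ _ (nbhs _) (nbhs _)).
  by exists y.
Qed.

Lemma measurable_borelX (T U : ptopologicalType) (A : set (borel T))
    (B : set (borel U)) : measurable A -> measurable B ->
  (measurable : set (set (borel (T * U)%type))) (A `*` B).
Proof.
move=> mA mB.
have -> : A `*` B = fst @^-1` A `&` snd @^-1` B :> set (T * U) by [].
apply: (@measurableI _ (borel (T * U)%type)).
  rewrite -[X in measurable X]setTI.
  exact: (continuous_borel (fun x : T * U => cvg_fst (F := nbhs x.1))
    measurableT mA).
rewrite -[X in measurable X]setTI.
exact: (continuous_borel (fun x : T * U => cvg_snd (F := nbhs x.1))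
  measurableT mB).
Qed.

Section radon_prod.
Context (R : realType) (T U : ptopologicalType).
Local Notation TU := (T * U)%type.
Local Notation BTU := (borel T * borel U)%type.
Hypotheses (hT : hausdorff_space T) (hU : hausdorff_space U).
Hypothesis open_prod_measurable : forall O : set TU, open O ->
  (measurable : set (set BTU)) O.

(** This transports the product measure, which lives on the product
sigma-algebra, to the Borel sets of the product topology. *)
Lemma prod_borel_measurable_id :
  measurable_fun [set: BTU] (id : BTU -> borel TU).
Proof.
apply: (@measurability _ _ BTU (borel TU) _ _ (@open TU)) => //.
by move=> _ [B oB <-]; rewrite setTI; exact: open_prod_measurable.
Qed.

(** Inner regularity has to be checked only for the cylinders that generate the
product sigma-algebra and for their complements, which are again cylinders; for
a rectangle, the product of compact subsets of its sides does it. *)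
Lemma radon_prod (p : radon_measure R T) (q : radon_measure R U) :
  exists rho : radon_measure R TU, forall A, rho A = (p \x q)%E A.
Proof.
have pqE (A : set (borel T)) (B : set (borel U)) : measurable A ->
    measurable B -> (p \x q)%E (A `*` B) = (p A * q B)%E.
  by move=> mA mB; exact: product_measure1E.
have [|pq pqeq] := @ex_finite_measure R _ _ (p \x q)%E.
  rewrite -setXTT [X in (X < _)%E]pqE// ltey_eq fin_numM ?fin_num_measure//.
have mid := prod_borel_measurable_id.
have [m mE] := ex_finite_pushforward pq mid.
have {mE}mE A : m A = (p \x q)%E A by rewrite mE /pushforward pqeq.
have hTU := hausdorff_prod hT hU.
suff reg : forall D : set (borel TU), measurable D -> inner_regular m D.
  have [rho rhoE] := radon_measureP hTU reg.
  by exists rho => B; rewrite rhoE mE.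
have mX := @measurable_borelX T U.
have div1M (u v : R) : 0 <= u -> 0 <= v -> u / (v + 1) * v <= u.
  move=> u0 v0; rewrite mulrAC ler_pdivrMr ?ltr_wpDl//.
  by rewrite ler_wpM2l// lerDl.
have regX (A : set (borel T)) (C : set (borel U)) : measurable A ->
    measurable C -> inner_regular m (A `*` C).
  move=> mA mC e e0.
  have [a pa] : exists a, p setT = a%:E.
    by exists (fine (p setT)); rewrite fineK// fin_num_measure.
  have [b qb] : exists b, q setT = b%:E.
    by exists (fine (q setT)); rewrite fineK// fin_num_measure.
  have a0 : 0 <= a by rewrite -lee_fin -pa.
  have b0 : 0 <= b by rewrite -lee_fin -qb.
  have ea : 0 < e / 2 / (a + 1) by rewrite !divr_gt0// ltr_wpDl.
  have eb : 0 < e / 2 / (b + 1) by rewrite !divr_gt0// ltr_wpDl.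
  have [K [cK bK KA pK]] := radon_val_regular p mA eb.
  have [L [cL bL LC qL]] := radon_val_regular q mC ea.
  exists (K `*` L); split; first exact: compact_setX.
    by move=> [x y] [/= Kx Ly]; split; [exact: KA|exact: LC].
  apply: (@le_trans _ _ (m (((A `\` K) `*` setT) `|` (setT `*` (C `\` L))))).
    apply: le_measure; rewrite ?inE.
    - by apply: measurableD; apply: mX.
    - by apply: measurableU; apply: mX => //; apply: measurableD.
    - move=> [x y] [[/= Ax Cy] nKL]; have [Kx|nKx] := pselect (K x).
        by right; split => //; split => // Ly; exact: nKL.
      by left; split.
  suff : (m ((A `\` K) `*` setT) + m (setT `*` (C `\` L)) <= e%:E)%E.
    by apply: le_trans; apply: measureU2; apply: mX => //; apply: measurableD.
  rewrite !mE !pqE//; try exact: measurableD.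
  rewrite pa qb [e in leRHS](splitr e) EFinD; apply: leeD.
  - apply: (@le_trans _ _ ((e / 2 / (b + 1))%:E * b%:E)%E).
      by apply: lee_wpmul2r; rewrite ?lee_fin.
    by rewrite -EFinM lee_fin; apply: div1M => //; rewrite ltW// divr_gt0.
  - apply: (@le_trans _ _ (a%:E * (e / 2 / (a + 1))%:E)%E).
      by apply: lee_wpmul2l; rewrite ?lee_fin.
    by rewrite -EFinM lee_fin mulrC; apply: div1M => //; rewrite ltW// divr_gt0.
move=> B mB.
have {}mB : (measurable : set (set BTU)) B.
  by rewrite -[X in measurable X]setTI; exact: (mid measurableT _ mB).
apply: (inner_regular_generated hTU _ _ mB).
  by rewrite -setXTT; exact: regX.
move=> _ [|] [A mA <-]; rewrite setTI.
- rewrite -setXT; split; [exact: mX|exact: regX|].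
  rewrite (_ : ~` _ = (~` A) `*` setT); last first.
    by apply/seteqP; split=> [[x y] nA|[x y] [nA _] [Ax _]//]; split => //= Ax;
       exact: nA.
  by apply: regX => //; exact: measurableC.
- rewrite -setTX; split; [exact: mX|exact: regX|].
  rewrite (_ : ~` _ = setT `*` (~` A)); last first.
    by apply/seteqP; split=> [[x y] nA|[x y] [_ nA] [_ Ax]//]; split => //= Ax;
       exact: nA.
  by apply: regX => //; exact: measurableC.
Qed.

End radon_prod.

(** * The topology of a separable extended metric space *)

Section metric.
Context (R : realType) (X : pointedType) (d : X -> X -> \bar R).
Hypothesis dm : extended_metric d.

Lemma dist_piE x y : (dist_pi d x y)%:E = Order.min (d x y) (pi%:E)%E.
Proof.
have p0 := pi_gt0 R.
rewrite /dist_pi fineK// fin_numE; apply/andP; split.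
  rewrite gt_eqF// lt_min ltNyr andbT.
  by apply: lt_le_trans (extended_metric_ge0 dm x y).
by rewrite lt_eqF// gt_min ltry orbT.
Qed.

Lemma dist_pi_ge0 x y : 0 <= dist_pi d x y.
Proof.
by rewrite -lee_fin dist_piE le_min (extended_metric_ge0 dm) lee_fin pi_ge0.
Qed.

Lemma dist_pi_le x y : dist_pi d x y <= pi.
Proof. by rewrite -lee_fin dist_piE ge_min lexx orbT. Qed.

Lemma dist_pi_lt x y (e : R) : e <= pi ->
  (dist_pi d x y < e) = (d x y < e%:E)%E.
Proof.
move=> epi; rewrite -lte_fin dist_piE gt_min lte_fin [(pi < e)%R]ltNge epi.
by rewrite orbF.
Qed.

Lemma dist_pi_xx x : dist_pi d x x = 0.
Proof.
have xx : d x x = 0%E by exact/(extended_metric_eq0 dm).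
by apply: EFin_inj; rewrite dist_piE xx; apply/min_idPl; rewrite lee_fin pi_ge0.
Qed.

Lemma dist_pi_eq0 x y : dist_pi d x y = 0 -> x = y.
Proof.
move=> xy0; apply/(extended_metric_eq0 dm); apply/eqP.
rewrite eq_le (extended_metric_ge0 dm) andbT.
have := dist_piE x y; rewrite xy0 /Order.min.
by case: ifPn => [_ <-//|_ [pi0]]; have := pi_gt0 R; rewrite -pi0 ltxx.
Qed.

Lemma dist_pi_sym x y : dist_pi d x y = dist_pi d y x.
Proof. by rewrite /dist_pi (extended_metric_sym dm). Qed.

Lemma dist_pi_triangle x y z :
  dist_pi d x z <= dist_pi d x y + dist_pi d y z.
Proof.
rewrite -lee_fin EFinD !dist_piE.
have p0 : (0 <= pi%:E :> \bar R)%E by rewrite lee_fin pi_ge0.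
have := extended_metric_triangle dm x y z.
have := extended_metric_ge0 dm x y; have := extended_metric_ge0 dm y z.
move: (d x y) (d y z) (d x z) => u v w v0 u0 wuv.
rewrite ge_min; have [upi|upi] := leP u pi%:E.
  have [vpi|vpi] := leP v pi%:E; first by rewrite wuv.
  by rewrite leeDr// orbT.
have [vpi|vpi] := leP v pi%:E; first by rewrite [X in _ || X]leeDl// orbT.
by rewrite [X in _ || X]leeDl// orbT.
Qed.

(** The truncated distance is a finite metric, and it has the same small balls as
[d]; from here on only the truncation is used. *)
Lemma dspace_nbhsP x (U : set (dspace d)) :
  nbhs (x : dspace d) U <->
  exists2 e : R, 0 < e & [set y | dist_pi d x y < e] `<=` U.
Proof.
split.
  rewrite nbhsE => -[V [oV Vx] VU]; have [e e0 eV] := oV _ Vx.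
  exists (Order.min e pi); first by rewrite lt_min e0 pi_gt0.
  move=> y /=; rewrite dist_pi_lt ?ge_min ?lexx ?orbT// => xy.
  apply: VU; apply: eV => /=; apply: lt_le_trans xy _.
  by rewrite lee_fin ge_min lexx.
move=> [e e0 eU]; rewrite nbhsE.
exists [set y | dist_pi d x y < e] => //; split; last by rewrite /= dist_pi_xx.
move=> y /= xy; exists (Order.min (e - dist_pi d x y) pi).
  by rewrite lt_min subr_gt0 xy pi_gt0.
move=> z /=; rewrite -dist_pi_lt ?ge_min ?lexx ?orbT// lt_min => /andP[yz _].
by apply: (le_lt_trans (dist_pi_triangle x y z)); lra.
Qed.

Lemma dist_pi_lip x y x' y' :
  `|dist_pi d x y - dist_pi d x' y'| <= dist_pi d x x' + dist_pi d y y'.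
Proof.
have := dist_pi_triangle x x' y; have := dist_pi_triangle x' y' y.
have := dist_pi_triangle x' x y'; have := dist_pi_triangle x y y'.
rewrite (dist_pi_sym x' x) (dist_pi_sym y' y) => h1 h2 h3 h4.
by rewrite ler_norml; apply/andP; split; lra.
Qed.

Lemma near_dist_pi (x : dspace d) (e : R) : 0 < e ->
  \forall y \near x, dist_pi d x y < e.
Proof. by move=> e0; apply/dspace_nbhsP; exists e. Qed.

Lemma continuous_dist_pi :
  continuous (fun p : dspace d * dspace d => dist_pi d p.1 p.2).
Proof.
move=> [x y]; apply/cvgrPdist_lt => /= e e0.
have e20 : 0 < e / 2 by rewrite divr_gt0.
exists ([set x' | dist_pi d x x' < e / 2], [set y' | dist_pi d y y' < e / 2]).
  by split; exact: near_dist_pi.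
move=> [x' y'] [/= xx' yy']; apply: (le_lt_trans (dist_pi_lip _ _ _ _)).
by lra.
Qed.

Lemma continuous_dist_pir x : continuous (fun y : dspace d => dist_pi d x y).
Proof.
move=> y; apply/(cvgrPdist_lt (FF := @nbhs_filter (dspace d) y)) => /= e e0.
apply/dspace_nbhsP; exists e => // z /= yz.
apply: (le_lt_trans (dist_pi_lip _ _ _ _)).
by rewrite dist_pi_xx add0r.
Qed.

Lemma open_ball_dist_pi x (t : R) :
  @open (dspace d) [set y | dist_pi d x y < t].
Proof.
apply: (@open_comp _ _ (fun y : dspace d => dist_pi d x y) [set y | y < t]).
  by move=> y _; exact: continuous_dist_pir.
exact: open_lt.
Qed.

Lemma dspace_hausdorff : hausdorff_space (dspace d).
Proof.
move=> x y cl; apply: dist_pi_eq0; apply/eqP; rewrite eq_le dist_pi_ge0 andbT.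
apply/ler_addgt0Pr => e e0; rewrite add0r.
have e20 : 0 < e / 2 by rewrite divr_gt0.
have [z [/= xz yz]] := cl _ _ (near_dist_pi x e20) (near_dist_pi y e20).
by have := dist_pi_triangle x z y; rewrite (dist_pi_sym z y); lra.
Qed.

Lemma separable_sequence : separable_space (dspace d) ->
  exists s : nat -> X, forall x (e : R), 0 < e -> exists k, dist_pi d (s k) x < e.
Proof.
move=> [S cS dS].
have [z Sz] : S !=set0.
  have [y [_ Sy]] := dS setT (ex_intro _ point I) openT; by exists y.
have /pfcard_geP[S0|[s]] := cS; first by rewrite S0 in Sz.
exists s => x e e0.
have : nbhs (x : dspace d) [set y | dist_pi d x y < e] by exact: near_dist_pi.
rewrite nbhsE => -[V [oV Vx] Ve].
have [y [Vy Sy]] := dS V (ex_intro _ x Vx) oV.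
have [k _ ky] : exists2 k, setT k & s k = y.
  by have /(_ y Sy)[k _ ky] := @surj _ _ _ _ s; exists k.
exists k.
by rewrite ky dist_pi_sym; exact: Ve.
Qed.

Section countable_base.
Variable s : nat -> X.
Hypothesis s_dense : forall x (e : R), 0 < e -> exists k, dist_pi d (s k) x < e.

Definition base_ball (i : nat * nat) : set (dspace d) :=
  [set y | dist_pi d (s i.1) y < i.2.+1%:R^-1].

Lemma base_ball_open i : open (base_ball i).
Proof. exact: open_ball_dist_pi. Qed.

Lemma base_ball_nbhs (x : dspace d) (U : set (dspace d)) : nbhs x U ->
  exists2 i, base_ball i x & base_ball i `<=` U.
Proof.
move=> /dspace_nbhsP[e e0 eU].
have e20 : 0 < e / 2 by rewrite divr_gt0.
have [n] : exists n, n.+1%:R^-1 < e / 2.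
  have /cvgrPdist_lt/(_ _ e20)[n _ /(_ n (leqnn n))] := @cvg_harmonic R.
  by rewrite /= sub0r normrN ger0_norm// => h; exists n.
move=> ne; have [|k sk] := @s_dense x n.+1%:R^-1; first by rewrite invr_gt0.
exists (k, n) => // y /= sy; apply: eU => /=.
have := dist_pi_triangle x (s k) y; rewrite (dist_pi_sym x (s k)).
move: sk sy ne; rewrite /base_ball/=; move: (n.+1%:R^-1) => u.
by move=> h1 h2 h3 h4; lra.
Qed.

(** An open set is the union of the products of base balls that it contains, and
there are countably many of them. *)
Lemma open_prod_measurable (O : set (dspace d * dspace d)) : open O ->
  (measurable : set (set (borel (dspace d) * borel (dspace d)))) O.
Proof.
move=> oO.
pose I := ((nat * nat) * (nat * nat))%type.
pose BB (i : I) := base_ball i.1 `*` base_ball i.2.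
have -> : O = \bigcup_(i : I) (if pselect (BB i `<=` O) then BB i else set0).
  apply/seteqP; split => [[x y] Oxy|z [i _]]; last first.
    by case: pselect => // BO; exact: BO.
  have [[A B] [/= nA nB] ABO] : nbhs ((x, y) : dspace d * dspace d) O.
    exact: open_nbhs_nbhs.
  have [i ix iA] := base_ball_nbhs nA; have [j jy jB] := base_ball_nbhs nB.
  exists (i, j) => //; case: pselect => //; case=> z [z1 z2].
  by apply: ABO; split; [exact: iA|exact: jB].
apply: countable_bigcupT_measurable => [|i]; first exact: countableP.
by case: pselect => ?; [apply: measurableX; apply: open_borel;
  exact: base_ball_open|exact: measurable0].
Qed.

End countable_base.

End metric.

(** * The geometry of the cone *)

Lemma continuous_fst (T U : topologicalType) : continuous (@fst T U).
Proof. by move=> z; apply: cvg_fst. Qed.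

Lemma continuous_snd (T U : topologicalType) : continuous (@snd T U).
Proof. by move=> z; apply: cvg_snd. Qed.

Lemma continuous_pair (T U V : topologicalType) (f : T -> U) (g : T -> V) :
  continuous f -> continuous g -> continuous (fun x => (f x, g x)).
Proof. by move=> cf cg x; exact: (cvg_pair (cf x) (cg x)). Qed.

Lemma continuous_borel_real (R : realType) (T : ptopologicalType) (f : T -> R) :
  continuous f -> measurable_fun [set: borel T] (f : borel T -> R).
Proof.
move=> cf; apply: (@measurability _ _ (borel T) R _ _ (@RGenOInfty.G R)).
  exact: RGenOInfty.measurableE.
move=> _ [_ [x ->] <-]; rewrite setTI; apply: open_borel.
by apply: (@open_comp _ _ f) => [y _|]; [exact: cf|exact: interval_open].
Qed.

Section cone_metric.
Context (R : realType) (X : pointedType) (d : X -> X -> \bar R).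
Hypothesis dm : extended_metric d.
Local Notation C := (cone_space d).
Implicit Types p q : cone R X.

Lemma cone_r_ge0 p : 0 <= cone_r p.
Proof. by rewrite /cone_r. Qed.

(** The squared distance separates into a radial and an angular part, both
nonnegative. *)
Lemma cone_dist_sqr p q : cone_dist d p q ^+ 2 =
  (cone_r p - cone_r q) ^+ 2 +
  2 * cone_r p * cone_r q * (1 - cos (dist_pi d (cone_x p) (cone_x q))).
Proof.
rewrite /cone_dist sqr_sqrtr; first by ring.
have -> : forall r s c : R, r ^+ 2 + s ^+ 2 - 2 * r * s * c =
    (r - s) ^+ 2 + 2 * r * s * (1 - c) by move=> *; ring.
by rewrite addr_ge0 ?sqr_ge0// !mulr_ge0 ?cone_r_ge0// subr_ge0 cos_le1.
Qed.

Lemma cone_dist_ge0 p q : 0 <= cone_dist d p q.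
Proof. exact: sqrtr_ge0. Qed.

Lemma cone_dist_sym p q : cone_dist d p q = cone_dist d q p.
Proof.
apply/eqP; rewrite -(@eqrXn2 _ 2) ?cone_dist_ge0// !cone_dist_sqr (dist_pi_sym dm).
by apply/eqP; ring.
Qed.

Lemma cone_r_sqr_le p q : (cone_r p - cone_r q) ^+ 2 <= cone_dist d p q ^+ 2.
Proof.
by rewrite cone_dist_sqr lerDl !mulr_ge0 ?cone_r_ge0// subr_ge0 cos_le1.
Qed.

Lemma cone_r_lip p q : `|cone_r p - cone_r q| <= cone_dist d p q.
Proof.
by rewrite -ler_sqr ?nnegrE ?cone_dist_ge0// real_normK ?num_real// cone_r_sqr_le.
Qed.

(** The distance from [p] to the ray that makes an angle [t <= pi / 2] with the
ray of [p] is [cone_r p * sin t]. *)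
Lemma cone_dist_angle p q (t : R) : 0 <= t <= pi / 2 ->
  t <= dist_pi d (cone_x p) (cone_x q) ->
  cone_r p ^+ 2 * sin t ^+ 2 <= cone_dist d p q ^+ 2.
Proof.
move=> /andP[t0 tpi] tpq.
have c0 : 0 <= cos t by apply: cos_ge0_pihalf; have := pi_gt0 R; lra.
have ct : cos (dist_pi d (cone_x p) (cone_x q)) <= cos t.
  have p0 := pi_gt0 R; have := dist_pi_ge0 dm (cone_x p) (cone_x q).
  have := dist_pi_le dm (cone_x p) (cone_x q) => h1 h2.
  by rewrite leNgt ltr_cos -?leNgt ?in_itv//=; apply/andP; split; lra.
rewrite cone_dist_sqr sin2cos2.
have r0 := cone_r_ge0 p; have s0 := cone_r_ge0 q.
move: (cone_r p) (cone_r q) (cos t) (cos (dist_pi _ _ _)) r0 s0 c0 ct => r s c c' r0 s0 c0 cc.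
have rscc : 0 <= r * s * (c - c') by rewrite !mulr_ge0// subr_ge0.
rewrite -subr_ge0.
rewrite (_ : _ - _ = (s - r * c) ^+ 2 + 2 * (r * s * (c - c'))); last by ring.
by rewrite addr_ge0 ?sqr_ge0// mulr_ge0.
Qed.

Lemma coneP p q : cone_r p = cone_r q -> (0 < cone_r p -> cone_x p = cone_x q) ->
  p = q.
Proof.
rewrite /cone_x -(reprK p) -(reprK q) => rpq xpq.
apply/eqmodP; rewrite /= /cone_eq; move: rpq xpq.
rewrite /cone_r !reprK => rpq; rewrite -rpq.
have [r0|r0] := ltP 0 (repr p).2%:num.
  move=> /(_ isT) xpq; rewrite (_ : repr p = repr q) ?eqxx//.
  move: xpq rpq; case: (repr p) (repr q) => [x r] [y s] /= -> rs.
  by congr pair; apply: val_inj.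
move=> _; have -> : (repr p).2%:num = 0 by apply/eqP; rewrite eq_le r0/=.
by rewrite eqxx orbT.
Qed.

Lemma cone_openP (A : set C) :
  (forall p, A p -> exists2 e : R, 0 < e & [set q | cone_dist d p q < e] `<=` A) ->
  open A.
Proof.
move=> h; rewrite -[open A]/(dspace_open (fun p q => (cone_dist d p q)%:E) A).
move=> p Ap; have [e e0 eA] := h p Ap; by exists e.
Qed.

Lemma continuous_cone_r : continuous (fun p : C => cone_r p).
Proof.
apply/continuousP => A oA; apply: cone_openP => p Ap.
have /nbhs_ballP[e /= e0 eA] : nbhs (cone_r p) A by exact: open_nbhs_nbhs.
exists e => // q /= pq; apply: eA; rewrite /ball/=.
exact: le_lt_trans (cone_r_lip p q) pq.
Qed.

(** The projection [cone_x] is continuous away from the vertex: a point closer to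
[p] than [cone_r p * sin t] has a positive radius and a direction closer than
[t]. *)
Lemma open_cone_x (U : set (dspace d)) : open U ->
  open [set p : C | 0 < cone_r p /\ U (cone_x p)].
Proof.
move=> oU; apply: cone_openP => p [r0 Up].
have /(dspace_nbhsP dm)[e e0 eU] : nbhs (cone_x p : dspace d) U.
  exact: open_nbhs_nbhs.
have p0 := pi_gt0 R.
pose t := Order.min e (pi / 2).
have t0 : 0 < t by rewrite lt_min e0 divr_gt0.
have tpi : t <= pi / 2 by rewrite ge_min lexx orbT.
have s0 : 0 < sin t by apply: sin_gt0_pi; rewrite t0; lra.
exists (cone_r p * sin t); first by rewrite mulr_gt0.
move=> q /= pq; split.
  have := le_lt_trans (cone_r_lip p q) pq.
  have : cone_r p * sin t <= cone_r p by rewrite ler_piMr ?sin_le1// ltW.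
  by rewrite ltr_norml => ? /andP[_]; lra.
apply: eU => /=; apply: (@lt_le_trans _ _ t); last by rewrite ge_min lexx.
rewrite ltNge; apply/negP => /cone_dist_angle.
rewrite (ltW t0) tpi => /(_ isT); apply/negP; rewrite -ltNge -exprMn.
by rewrite ltr_pXn2r ?nnegrE ?cone_dist_ge0// mulr_ge0 ?ltW.
Qed.

Lemma cone_hausdorff : hausdorff_space C.
Proof.
move=> p q cl.
have rpq : cone_r p = cone_r q.
  apply: (@Rhausdorff R) => A B /continuous_cone_r nA /continuous_cone_r nB.
  by have [z [Az Bz]] := cl _ _ nA nB; exists (cone_r z).
apply: coneP => // r0; apply: (dspace_hausdorff dm) => A B.
rewrite !nbhsE => -[A' [oA Ap] AA] [B' [oB Bq] BB].
have [||z [[_ Az] [_ Bz]]] := cl [set z : C | 0 < cone_r z /\ A' (cone_x z)]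
    [set z : C | 0 < cone_r z /\ B' (cone_x z)].
- by apply: open_nbhs_nbhs; split; [exact: open_cone_x|].
- by apply: open_nbhs_nbhs; split; [exact: open_cone_x|split; rewrite -?rpq].
- by exists (cone_x z); split; [exact: AA|exact: BB].
Qed.

Lemma continuous_cone_pt (a : {nonneg R}) :
  continuous (fun x : dspace d => @cone_pt R X x a : C).
Proof.
apply/continuousP => A oA; rewrite openE => x Ax.
have [e e0 eA] := oA _ Ax.
pose g (t : R) := Num.sqrt (a%:num ^+ 2 + a%:num ^+ 2 - 2 * a%:num * a%:num * cos t).
have g0 : g 0 = 0.
  by rewrite /g cos0 mulr1 (_ : _ - _ = 0) ?sqrtr0//; ring.
have cg : {for 0, continuous g}.
  apply: continuous_comp; last exact: sqrt_continuous.
  apply: cvgB; first exact: cvg_cst.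
  by apply: cvgM; [exact: cvg_cst|exact: continuous_cos].
have /cvgrPdist_lt/(_ _ e0)/nbhs_ballP[t /= t0 tg] := cg.
apply/(dspace_nbhsP dm); exists t => // y /= xy; apply: eA => /=.
rewrite lte_fin cone_distE.
have := tg (dist_pi d x y); rewrite /ball/= sub0r normrN ger0_norm ?dist_pi_ge0//.
move=> /(_ xy); rewrite g0 sub0r normrN; apply: le_lt_trans.
exact: ler_norm.
Qed.

Section separable.
Variable s : nat -> X.
Hypothesis s_dense : forall x (e : R), 0 < e -> exists k, dist_pi d (s k) x < e.
Local Notation X' := (dspace d).

(** [cone_x] need not be continuous at the vertex, where its value is arbitrary, but
the vertex is a closed set. *)
Lemma measurable_cone_x :
  measurable_fun [set: borel C] (fun p : borel C => cone_x p : borel X').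
Proof.
apply: (@measurability _ _ (borel C) (borel X') _ _ (@open X')) => //.
move=> _ [U oU <-]; rewrite setTI.
have m0 : (measurable : set (set (borel C))) [set p | cone_r p = 0].
  rewrite -[X in measurable X]setTI.
  exact: (continuous_borel_real continuous_cone_r measurableT (measurable_set1 0)).
have mU := open_borel (open_cone_x oU).
have m0U : (measurable : set (set (borel C)))
    [set p | cone_r p = 0 /\ U (point : X)].
  have [Up|nUp] := pselect (U (point : X)).
    by rewrite (_ : [set _ | _] = [set p | cone_r p = 0])//;
       apply/seteqP; split => [p []|p].
  by rewrite (_ : [set _ | _] = set0)//; apply/seteqP; split => [p []|p].
rewrite (_ : _ @^-1` _ = [set p : C | 0 < cone_r p /\ U (cone_x p)] `|`
  [set p | cone_r p = 0 /\ U (point : X)]); first exact: measurableU.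
apply/seteqP; split => [p Up|p [[]//|[r0 Up]]].
- have [r0|r0] := ltP 0 (cone_r p); first by left.
  have r00 : cone_r p = 0 by apply/eqP; rewrite eq_le r0 cone_r_ge0.
  by right; split => //; move: Up; rewrite /= /cone_x r00 ltxx.
- by rewrite /= /cone_x r0 ltxx.
Qed.

(** Separability enters: the truncated distance is continuous, hence Borel, on
the product, but it has to be measurable for the product sigma-algebra. *)
Lemma measurable_dist_pi : measurable_fun [set: borel X' * borel X']
  (fun z => dist_pi d z.1 z.2).
Proof.
have mid := @prod_borel_measurable_id X' X' (open_prod_measurable dm s_dense).
exact: (measurableT_comp (continuous_borel_real (continuous_dist_pi dm)) mid).
Qed.

Lemma measurable_pr_cone_x (pr : C * C -> C) : continuous pr ->
  measurable_fun [set: borel (C * C)%type]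
  (fun z : borel (C * C)%type => cone_x (pr z) : borel X').
Proof.
by move=> cpr; apply: (measurableT_comp measurable_cone_x); exact: continuous_borel.
Qed.

Lemma measurable_pr_cone_r (pr : C * C -> C) : continuous pr ->
  measurable_fun [set: borel (C * C)%type]
  (fun z : borel (C * C)%type => cone_r (pr z)).
Proof.
move=> cpr; apply: continuous_borel_real => z.
by apply: continuous_comp; [exact: cpr|exact: continuous_cone_r].
Qed.

Lemma measurable_cone_dist_sqr : measurable_fun [set: borel (C * C)%type]
  (fun z : borel (C * C)%type => cone_dist d z.1 z.2 ^+ 2).
Proof.
under eq_fun do rewrite cone_dist_sqr.
have mr1 := measurable_pr_cone_r (@continuous_fst C C).
have mr2 := measurable_pr_cone_r (@continuous_snd C C).
have mx1 := measurable_pr_cone_x (@continuous_fst C C).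
have mx2 := measurable_pr_cone_x (@continuous_snd C C).
apply: measurable_funD; first by apply: measurable_funX; exact: measurable_funB.
apply: measurable_funM.
  by apply: measurable_funM => //; exact: measurable_funM.
apply: measurable_funB => //.
apply: (measurableT_comp (continuous_measurable_fun (@continuous_cos R))).
exact: (measurableT_comp measurable_dist_pi (measurable_fun_pair mx1 mx2)).
Qed.

End separable.
End cone_metric.

(** * Transport plans on the cone *)

Section plans.
Context (R : realType) (X : pointedType) (d : X -> X -> \bar R).
Hypothesis dm : extended_metric d.
Variable s : nat -> X.
Hypothesis s_dense : forall x (e : R), 0 < e -> exists k, dist_pi d (s k) x < e.
Local Notation C := (cone_space d).
Local Notation CC := (C * C)%type.
Local Notation X' := (dspace d).
Implicit Types (m : set (borel X') -> \bar R) (alpha : radon_measure R CC).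

Let hCC : hausdorff_space CC.
Proof. by apply: hausdorff_prod; exact: cone_hausdorff. Qed.

(** The marginals are arbitrary set functions, so that plans can be added
before the sums of their marginals are identified with Radon measures. *)
Definition plan m1 m2 (c : R) := exists alpha, [/\
  forall B, measurable B -> hmarginal fst alpha B = m1 B,
  forall B, measurable B -> hmarginal snd alpha B = m2 B &
  (HK_cost alpha <= c%:E)%E].

Lemma measurable_hmarginal_set (pr : CC -> C) (B : set (borel X')) :
  continuous pr -> measurable B ->
  (measurable : set (set (borel CC))) [set z | B (cone_x (pr z))].
Proof.
move=> cpr mB; rewrite -[X in measurable X]setTI.
exact: (measurable_pr_cone_x dm cpr measurableT mB).
Qed.

Lemma measurable_cone_r_sqr (pr : CC -> C) : continuous pr ->
  measurable_fun [set: borel CC]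
    (fun z : borel CC => (cone_r (pr z) ^+ 2)%:E).
Proof.
move=> cpr; apply/measurable_EFinP; apply: measurable_funX.
exact: measurable_pr_cone_r.
Qed.

Lemma measurable_cost : measurable_fun [set: borel CC]
  (fun z : borel CC => (cone_dist d z.1 z.2 ^+ 2)%:E).
Proof.
by apply/measurable_EFinP; exact: (measurable_cone_dist_sqr dm s_dense).
Qed.

Lemma HK_cost_ge0 alpha : (0 <= HK_cost alpha)%E.
Proof. by apply: integral_ge0 => z _; rewrite lee_fin sqr_ge0. Qed.

Lemma plan_le m1 m2 c c' : c <= c' -> plan m1 m2 c -> plan m1 m2 c'.
Proof.
move=> cc' [a [a1 a2 ac]]; exists a; split => //.
by apply: le_trans ac _; rewrite lee_fin.
Qed.

Lemma plan_eq m1 m2 m1' m2' c : (forall B, measurable B -> m1 B = m1' B) ->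
  (forall B, measurable B -> m2 B = m2' B) -> plan m1 m2 c -> plan m1' m2' c.
Proof.
move=> h1 h2 [a [a1 a2 ac]]; exists a; split => //.
by move=> B mB; rewrite a1// h1.
by move=> B mB; rewrite a2// h2.
Qed.

Lemma plan_sym m1 m2 c : plan m1 m2 c -> plan m2 m1 c.
Proof.
move=> [a [a1 a2 ac]].
pose sw (z : CC) : CC := (z.2, z.1).
have cs : continuous sw.
  exact: continuous_pair (@continuous_snd _ _) (@continuous_fst _ _).
have [b bE] := radon_push a hCC cs.
have ms := continuous_borel cs.
have push (f : borel CC -> \bar R) (D : set (borel CC)) : measurable D ->
    measurable_fun setT f -> (forall z, 0 <= f z)%E ->
    (\int[b]_(z in D) f z = \int[a]_(z in sw @^-1` D) f (sw z))%E.
  move=> mD mf f0; rewrite (eq_measure_integral (pushforward a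
    (sw : borel CC -> borel CC))); last by move=> A _ _; exact: bE.
  by rewrite ge0_integral_pushforward//; exact: measurable_funTS.
exists b; split.
- move=> B mB; rewrite -a2// /hmarginal /pushforward push//.
  + by apply: measurable_hmarginal_set => //; exact: continuous_fst.
  + by apply: measurable_cone_r_sqr; exact: continuous_fst.
  + by move=> z; rewrite lee_fin sqr_ge0.
- move=> B mB; rewrite -a1// /hmarginal /pushforward push//.
  + by apply: measurable_hmarginal_set => //; exact: continuous_snd.
  + by apply: measurable_cone_r_sqr; exact: continuous_snd.
  + by move=> z; rewrite lee_fin sqr_ge0.
- rewrite /HK_cost push; [|exact: measurableT| |].
  + by rewrite preimage_setT; under eq_integral do rewrite cone_dist_sym//.
  + exact: measurable_cost.
  + by move=> z; rewrite lee_fin sqr_ge0.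
Qed.

Lemma plan_add m1 m2 c m1' m2' c' : plan m1 m2 c -> plan m1' m2' c' ->
  plan (fun B => m1 B + m1' B)%E (fun B => m2 B + m2' B)%E (c + c').
Proof.
move=> [a [a1 a2 ac]] [a' [a1' a2' ac']].
have [b bE] := radon_add a a' hCC.
have addI (f : borel CC -> \bar R) (D : set (borel CC)) : measurable D ->
    measurable_fun setT f -> (forall z, 0 <= f z)%E ->
    (\int[b]_(z in D) f z = \int[a]_(z in D) f z + \int[a']_(z in D) f z)%E.
  move=> mD mf f0; rewrite (eq_measure_integral (measure_add a a')).
    by rewrite ge0_integral_measure_add//; exact: measurable_funTS.
  by move=> A _ _; rewrite [RHS]measure_addE; exact: bE.
exists b; split.
- move=> B mB; rewrite -a1// -a1'// /hmarginal /pushforward addI//.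
  + by apply: measurable_hmarginal_set => //; exact: continuous_fst.
  + by apply: measurable_cone_r_sqr; exact: continuous_fst.
  + by move=> z; rewrite lee_fin sqr_ge0.
- move=> B mB; rewrite -a2// -a2'// /hmarginal /pushforward addI//.
  + by apply: measurable_hmarginal_set => //; exact: continuous_snd.
  + by apply: measurable_cone_r_sqr; exact: continuous_snd.
  + by move=> z; rewrite lee_fin sqr_ge0.
- rewrite /HK_cost addI//.
  + by rewrite EFinD; exact: leeD.
  + exact: measurable_cost.
  + by move=> z; rewrite lee_fin sqr_ge0.
Qed.

Lemma sqrte_ltE (x : \bar R) (e : R) : (0 <= x)%E -> 0 < e ->
  (sqrte x < e%:E)%E = (x < (e ^+ 2)%:E)%E.
Proof.
case: x => [r| |]//= r0 e0; rewrite !lte_fin.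
by rewrite -ltr_sqr ?nnegrE ?sqrtr_ge0 ?ltW// sqr_sqrtr.
Qed.

(** The finiteness of the second moment required by [HK_plans] comes for free: it
is the sum of the masses of the marginals. *)
Lemma HK_lt (mu nu : radon_measure R X') (e : R) : 0 < e ->
  (HK d mu nu < e%:E)%E <-> exists2 c, c < e ^+ 2 & plan mu nu c.
Proof.
move=> e0; rewrite /HK sqrte_ltE//; last first.
  by apply: le_ereal_inf_tmp => _ [a _ <-]; exact: HK_cost_ge0.
split.
  move=> /ereal_inf_lt[_ [a [_ a1 a2] <-]] ae.
  have af : HK_cost a \is a fin_num.
    by rewrite ge0_fin_numE ?HK_cost_ge0//; apply: lt_trans ae _; rewrite ltry.
  exists (fine (HK_cost a)); first by rewrite -lte_fin fineK.
  by exists a; split => //; rewrite fineK.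
move=> [c ce [a [a1 a2 ac]]].
apply: (@le_lt_trans _ _ (HK_cost a)); last first.
  by apply: le_lt_trans ac _; rewrite lte_fin.
apply: ereal_inf_lbound; exists a => //; split => //.
under eq_integral do rewrite EFinD.
rewrite ge0_integralD//.
- have := a1 _ measurableT; rewrite /hmarginal /pushforward preimage_setT => ->.
  have := a2 _ measurableT; rewrite /hmarginal /pushforward preimage_setT => ->.
  by rewrite lte_add_pinfty// ltey_eq fin_num_measure.
- by move=> z _; rewrite lee_fin sqr_ge0.
- by apply: measurable_cone_r_sqr; exact: continuous_fst.
- by move=> z _; rewrite lee_fin sqr_ge0.
- by apply: measurable_cone_r_sqr; exact: continuous_snd.
Qed.

Lemma HK_sym (mu nu : radon_measure R X') (e : R) : 0 < e ->
  (HK d mu nu < e%:E)%E -> (HK d nu mu < e%:E)%E.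
Proof.
move=> e0 /(HK_lt _ _ e0)[c ce pc]; apply/HK_lt => //.
by exists c => //; exact: plan_sym.
Qed.

Section block.
Variables (p q : radon_measure R X') (a b : {nonneg R}).

Let h (w : X' * X') : CC := (@cone_pt R X w.1 a, @cone_pt R X w.2 b).

Let ch : continuous h.
Proof.
apply: continuous_pair => w.
  by apply: (@continuous_comp _ _ _ fst (fun x : X' => @cone_pt R X x a : C));
    [exact: continuous_fst|exact: continuous_cone_pt].
by apply: (@continuous_comp _ _ _ snd (fun x : X' => @cone_pt R X x b : C));
  [exact: continuous_snd|exact: continuous_cone_pt].
Qed.

(** The product of [p] and [q], lifted to the cone at the constant radii [a] and
[b]. The integrand of the cost is bounded on [S `*` S] only, but this set has
full measure. *)
Lemma plan_block (S : set (borel X')) (k : R) :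
  measurable S -> p (~` S) = 0%E -> q (~` S) = 0%E -> 0 <= k ->
  (forall x y, S x -> S y -> 1 - cos (dist_pi d x y) <= k) ->
  plan (fun B => (a%:num ^+ 2)%:E * (p B * q setT))%E
       (fun B => (b%:num ^+ 2)%:E * (p setT * q B))%E
       (((a%:num - b%:num) ^+ 2 + 2 * a%:num * b%:num * k) *
         (fine (p setT) * fine (q setT))).
Proof.
move=> mS pS qS k0 Sk.
have hX := dspace_hausdorff dm.
have [rho rhoE] := radon_prod hX hX (open_prod_measurable dm s_dense) p q.
have rhoX (A B : set (borel X')) : measurable A -> measurable B ->
    rho (A `*` B) = (p A * q B)%E.
  by move=> mA mB; rewrite rhoE; exact: product_measure1E.
have mX := @measurable_borelX X' X'.
have [al alE] := radon_push rho hCC ch.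
have mh := continuous_borel ch.
have push (f : borel CC -> \bar R) (D : set (borel CC)) : measurable D ->
    measurable_fun setT f -> (forall z, 0 <= f z)%E ->
    (\int[al]_(z in D) f z = \int[rho]_(w in h @^-1` D) f (h w))%E.
  move=> mD mf f0; rewrite (eq_measure_integral (pushforward rho
    (h : borel _ -> borel CC))); last by move=> A _ _; exact: alE.
  by rewrite ge0_integral_pushforward//; exact: measurable_funTS.
exists al; split.
- move=> B mB; rewrite /hmarginal /pushforward push//; last first.
  + by move=> z; rewrite lee_fin sqr_ge0.
  + by apply: measurable_cone_r_sqr; exact: continuous_fst.
  + by apply: measurable_hmarginal_set => //; exact: continuous_fst.
  under eq_integral do rewrite /h/= cone_rE.
  have [a0|a0] := eqVneq a%:num 0.
    by rewrite a0 expr0n/= mul0e integral0.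
  rewrite (_ : _ @^-1` _ = B `*` setT); last first.
    apply/seteqP; split=> [[x y]/=|[x y]/=]; rewrite cone_xE lt_neqAle eq_sym a0 ge0//.
    by case.
  have mBT := mX _ _ mB measurableT.
  by rewrite integral_cst//; congr (_ * _)%E; exact: rhoX.
- move=> B mB; rewrite /hmarginal /pushforward push//; last first.
  + by move=> z; rewrite lee_fin sqr_ge0.
  + by apply: measurable_cone_r_sqr; exact: continuous_snd.
  + by apply: measurable_hmarginal_set => //; exact: continuous_snd.
  under eq_integral do rewrite /h/= cone_rE.
  have [b0|b0] := eqVneq b%:num 0.
    by rewrite b0 expr0n/= mul0e integral0.
  rewrite (_ : _ @^-1` _ = setT `*` B); last first.
    apply/seteqP; split=> [[x y]/=|[x y]/=]; rewrite cone_xE lt_neqAle eq_sym b0 ge0//.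
    by case.
  have mTB := mX _ _ measurableT mB.
  by rewrite integral_cst//; congr (_ * _)%E; exact: rhoX.
- rewrite /HK_cost push; [|exact: measurableT|exact: measurable_cost|]; last first.
    by move=> z; rewrite lee_fin sqr_ge0.
  rewrite preimage_setT.
  set K := (_ + _ * k).
  have K0 : 0 <= K by rewrite addr_ge0 ?sqr_ge0// !mulr_ge0.
  have rhoT : rho setT = (p setT * q setT)%E.
    by rewrite -rhoX// setXTT.
  apply: (@le_trans _ _ (\int[rho]_w (cst K%:E w))%E); last first.
    rewrite integral_cst// EFinM EFinM !fineK ?fin_num_measure//.
    by rewrite -rhoT.
  apply: ae_ge0_le_integral => //.
  + by move=> w _; rewrite lee_fin sqr_ge0.
  + exact: (measurableT_comp measurable_cost mh).
  + exists (~` (S `*` S)); split.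
    * by apply: measurableC; exact: mX.
    * have mSS : (measurable : set (set (borel (X' * X')%type))) (S `*` S).
        exact: mX.
      have mSC := measurableC mS.
      have rho1 : rho ((~` S) `*` setT) = 0%E by rewrite rhoX// pS mul0e.
      have rho2 : rho (setT `*` (~` S)) = 0%E by rewrite rhoX// qS mule0.
      have mST := mX _ _ mSC measurableT; have mTS := mX _ _ measurableT mSC.
      apply/eqP; rewrite eq_le measure_ge0 andbT.
      have : (rho (~` S `*` setT) + rho (setT `*` ~` S) <= 0)%E.
        by rewrite rho1 rho2 adde0.
      apply: le_trans; apply: le_trans (measureU2 rho mST mTS).
      apply: le_measure; rewrite ?inE; [exact: measurableC|exact: measurableU|].
      move=> [x y] nSS; have [Sx|nSx] := pselect (S x).
        by right; split => // Sy; exact: nSS.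
      by left; split.
    * move=> [x y]/= nK [Sx Sy]; apply: nK => _.
      rewrite lee_fin cone_dist_sqr !cone_rE lerD2l !cone_xE.
      have [a0|a0] := eqVneq a%:num 0; first by rewrite a0 !(mulr0, mul0r).
      have [b0|b0] := eqVneq b%:num 0; first by rewrite b0 !(mulr0, mul0r).
      rewrite !lt_neqAle ![0 == _]eq_sym a0 b0 !ge0/=.
      by apply: ler_wpM2l; [rewrite !mulr_ge0|exact: Sk].
Qed.

End block.
End plans.

(** * Plans between measures carried by a small set *)

Section upper_bound.
Context (R : realType) (X : pointedType) (d : X -> X -> \bar R).
Hypothesis dm : extended_metric d.
Variable s : nat -> X.
Hypothesis s_dense : forall x (e : R), 0 < e -> exists k, dist_pi d (s k) x < e.
Local Notation X' := (dspace d).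
Local Notation M := (radon_measure R X').

Let hX : hausdorff_space X' := dspace_hausdorff dm.

Definition mass (p : M) : R := fine (p setT).

Lemma massE (p : M) : (mass p)%:E = p setT.
Proof. by rewrite /mass fineK// fin_num_measure. Qed.

Lemma mass_ge0 (p : M) : 0 <= mass p.
Proof. exact: fine_ge0. Qed.

Lemma mass0 (p : M) : mass p = 0 -> forall B, measurable B -> p B = 0%E.
Proof.
move=> p0 B mB; apply/eqP; rewrite eq_le measure_ge0 andbT.
by rewrite -[leRHS](congr1 EFin p0) massE; apply: le_measure; rewrite ?inE.
Qed.

Lemma sqr_sub_sqrt_le (m n : R) : 0 <= m -> 0 <= n ->
  (Num.sqrt m - Num.sqrt n) ^+ 2 <= `|m - n|.
Proof.
move=> m0 n0; rewrite -{2}(sqr_sqrtr m0) -{2}(sqr_sqrtr n0).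
have := sqrtr_ge0 m; have := sqrtr_ge0 n.
move: (Num.sqrt m) (Num.sqrt n) => a b b0 a0.
rewrite subr_sqr normrM -real_normK ?num_real// expr2 ler_wpM2l//.
by rewrite (ger0_norm (addr_ge0 a0 b0)) ler_norml; apply/andP; split; lra.
Qed.

(** All the mass of [p] is sent to the vertex. In terms of [plan_block] this is
the product with a Dirac mass, at radii [1] and [0]. *)
Lemma plan_vanish (p q : M) : mass q = 0 -> plan p q (mass p).
Proof.
move=> q0.
have [delta deltaE] := radon_dirac (NngNum (@ler01 R)) (point : X') hX.
have dT : delta setT = 1%E by rewrite deltaE mul1e diracT.
have cos2 (x y : X) : [set: borel X'] x -> [set: borel X'] y ->
    1 - cos (dist_pi d x y) <= 2 by have := cos_geN1 (dist_pi d x y); lra.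
have vT (r : M) : r (~` setT) = 0%E by rewrite setCT measure0.
have := @plan_block _ _ d dm s s_dense p delta (NngNum ler01) (NngNum (lexx 0)) setT 2 measurableT
  (vT p) (vT delta) (ler0n _ 2) cos2.
rewrite dT/=.
set c := (X in plan _ _ X).
have -> : c = mass p by rewrite /c -/(mass p); ring.
move=> pl; apply: plan_eq pl => B mB; first by rewrite expr1n mul1e mule1.
by rewrite expr0n/= mul0e (mass0 q0).
Qed.

(** For positive masses [m] and [n], the radii [a = (sqrt n)^-1] and
[b = (sqrt m)^-1] give the product of [p] and [q] the marginals [p] and [q]; its
cost is at most [(sqrt m - sqrt n) ^+ 2 + 2 * sqrt m * sqrt n * k]. If one of
the masses vanishes, the other measure is sent to the vertex. *)
Lemma plan_local (p q : M) (S : set (borel X')) (k : R) :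
  measurable S -> p (~` S) = 0%E -> q (~` S) = 0%E -> 0 <= k ->
  (forall x y, S x -> S y -> 1 - cos (dist_pi d x y) <= k) ->
  plan p q (`|mass p - mass q| + k * (mass p + mass q)).
Proof.
move=> mS pS qS k0 Sk; have m0 := mass_ge0 p; have n0 := mass_ge0 q.
have km : 0 <= k * mass p by exact: mulr_ge0.
have kn : 0 <= k * mass q by exact: mulr_ge0.
have [mz|mz] := eqVneq (mass p) 0.
  apply: (plan_sym dm s_dense); apply: plan_le (plan_vanish q mz).
  by rewrite mz !add0r normrN ger0_norm// lerDl.
have [nz|nz] := eqVneq (mass q) 0.
  apply: plan_le (plan_vanish p nz).
  by rewrite nz addr0 subr0 ger0_norm// lerDl.
have mp : 0 < mass p by rewrite lt_neqAle eq_sym mz.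
have np : 0 < mass q by rewrite lt_neqAle eq_sym nz.
have sm0 : 0 < Num.sqrt (mass p) by rewrite sqrtr_gt0.
have sn0 : 0 < Num.sqrt (mass q) by rewrite sqrtr_gt0.
have a0 : 0 <= (Num.sqrt (mass q))^-1 by rewrite invr_ge0 ltW.
have b0 : 0 <= (Num.sqrt (mass p))^-1 by rewrite invr_ge0 ltW.
have := @plan_block _ _ d dm s s_dense p q (NngNum a0) (NngNum b0) S k
  mS pS qS k0 Sk.
rewrite /= -/(mass p) -/(mass q).
set c := (X in plan _ _ X) => pl.
have := sqr_sub_sqrt_le m0 n0.
have sE := sqr_sqrtr m0; have tE := sqr_sqrtr n0.
have cE : c = (Num.sqrt (mass p) - Num.sqrt (mass q)) ^+ 2 +
    2 * Num.sqrt (mass p) * Num.sqrt (mass q) * k.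
  rewrite /c -{3}sE -{3}tE; field.
  by rewrite !gt_eqF.
have := sqr_ge0 (Num.sqrt (mass p) - Num.sqrt (mass q)).
rewrite sqrrB sE tE => sq0 cc.
apply: (@plan_le _ _ _ _ _ c).
  rewrite cE sqrrB sE tE; apply: lerD => //.
  rewrite mulrC ler_wpM2l//; lra.
apply: plan_eq pl => B mB; rewrite exprVn ?sE ?tE -massE.
- by rewrite muleCA -EFinM mulVf// mule1.
- by rewrite muleA -EFinM mulVf// mul1e.
Qed.

End upper_bound.

(** * Partitions of unity *)

Section partition.
Context (R : realType) (X : pointedType) (d : X -> X -> \bar R).
Hypothesis dm : extended_metric d.
Variable s : nat -> X.
Hypothesis s_dense : forall x (e : R), 0 < e -> exists k, dist_pi d (s k) x < e.
Local Notation X' := (dspace d).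
Local Notation M := (radon_measure R X').
Implicit Types (mu nu p q : M) (f g : X' -> R).

Let hX : hausdorff_space X' := dspace_hausdorff dm.

Definition unit_valued g := continuous g /\ forall x, 0 <= g x <= 1.

Lemma unit_valued1 : unit_valued (fun=> 1).
Proof. by split; [exact: cst_continuous|move=> x; rewrite ler01 lexx]. Qed.

Lemma unit_valuedM f g : unit_valued f -> unit_valued g ->
  unit_valued (fun x => f x * g x).
Proof.
move=> [cf f01] [cg g01]; split => x.
  exact: continuousM (cf x) (cg x).
by have /andP[? ?] := f01 x; have /andP[? ?] := g01 x; rewrite mulr_ge0// mulr_ile1.
Qed.

Lemma unit_valuedB g : unit_valued g -> unit_valued (fun x => 1 - g x).
Proof.
move=> [cg g01]; split => x; first exact: (continuousB (@cst_continuous X' R 1 x) (cg x)).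
by have /andP[? ?] := g01 x; apply/andP; split; lra.
Qed.

Lemma unit_valued_measurable g : unit_valued g ->
  measurable_fun [set: borel X'] (g : borel X' -> R).
Proof. by case=> cg _; exact: continuous_borel_real. Qed.

Lemma unit_valued_bounded g : unit_valued g -> bounded_fun g.
Proof.
move=> [_ g01]; exists 1; split; first exact: num_real.
move=> K /ltW K1 x _ /=; apply: le_trans K1.
by have /andP[? ?] := g01 x; rewrite ger0_norm.
Qed.

Section tent.
Variable t : R.
Hypothesis t0 : 0 < t.

(** The value is [1] on the ball of radius [t / 2], and [0] outside the ball of
radius [t]. *)
Definition tent (x : X) : X' -> R :=
  fun y => Num.max 0 (Num.min 1 (2 - 2 * (dist_pi d x y / t))).

Lemma tent_unit_valued x : unit_valued (tent x).
Proof.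
split => y; last first.
  rewrite /tent le_max lexx/= ge_max ler01/=.
  by rewrite ge_min lexx.
have cc (c : R) : continuous (fun _ : X' => c) by exact: cst_continuous.
apply: (@continuous_max R X' (fun=> 0)); first exact: cc.
apply: (@continuous_min R X' (fun=> 1)); first exact: cc.
apply: (continuousB (cc 2 y)); apply: (continuousM (cc 2 y)).
exact: (continuousM (@continuous_dist_pir _ _ _ dm x y) (cc t^-1 y)).
Qed.

Lemma tent1 x y : dist_pi d x y < t / 2 -> tent x y = 1.
Proof.
move=> xy; rewrite /tent (_ : Num.min _ _ = 1); first by apply/max_idPr.
apply/min_idPl.
have : dist_pi d x y / t < 1 / 2 by rewrite ltr_pdivrMr// mulrC mul1r mulrC -mulrC.
lra.
Qed.

Lemma tent0 x y : t <= dist_pi d x y -> tent x y = 0.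
Proof.
move=> xy; apply/max_idPl; rewrite ge_min; apply/orP; right.
have : 1 <= dist_pi d x y / t by rewrite ler_pdivlMr// mul1r.
lra.
Qed.

(** The functions [pieces g l] add up to [g]: each point [x] of [l] splits off the
product of what is left with [tent x]. The last piece is [leftover g l], and the
other ones are supported in balls around the points of [l]. *)
Fixpoint pieces (g : X' -> R) (l : seq X) : seq (X' -> R) :=
  if l is x :: l' then
    (fun y => g y * tent x y) :: pieces (fun y => g y * (1 - tent x y)) l'
  else [:: g].

Fixpoint leftover (g : X' -> R) (l : seq X) : X' -> R :=
  if l is x :: l' then leftover (fun y => g y * (1 - tent x y)) l' else g.

Lemma leftover_unit_valued g l : unit_valued g -> unit_valued (leftover g l).
Proof.
elim: l g => [//|x l IH] g ug /=; apply: IH.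
by apply: unit_valuedM => //; apply: unit_valuedB; exact: tent_unit_valued.
Qed.

Lemma leftover0 g l y : (exists2 x, x \in l & dist_pi d x y < t / 2) ->
  leftover g l y = 0.
Proof.
have g0 l' : forall g', g' y = 0 -> leftover g' l' y = 0.
  by elim: l' => //= x l' IH g' g'0; apply: IH; rewrite g'0 mul0r.
elim: l g => [g [x]//|x l IH] g [z] /=; rewrite inE => /orP[/eqP ->|zl] zy.
  by apply: g0; rewrite (tent1 zy) subrr mulr0.
by apply: IH; exists z.
Qed.

End tent.

(** Stated as a relation because Radon measures with given values on the
measurable sets are only obtained up to their values on the other sets. *)
Definition is_density mu g p := forall B, measurable B ->
  p B = (\int[mu]_(x in B) (g x)%:E)%E.

Lemma ex_density mu g : unit_valued g -> exists p, is_density mu g p.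
Proof.
move=> ug; have [p pE] := radon_density mu hX (unit_valued_measurable ug) ug.2.
by exists p => B mB; exact: pE.
Qed.

Lemma density_mass mu g p : is_density mu g p -> mass p = \int[mu]_x g x.
Proof. by move=> pg; rewrite /mass pg. Qed.

Lemma density1 mu : is_density mu (fun=> 1) mu.
Proof. by move=> B mB; rewrite integral_cst// mul1e. Qed.

Lemma density_split mu f g p p1 p2 : unit_valued g -> unit_valued f ->
  is_density mu g p -> is_density mu (fun y => g y * f y) p1 ->
  is_density mu (fun y => g y * (1 - f y)) p2 ->
  forall B, measurable B -> (p1 B + p2 B = p B)%E.
Proof.
move=> ug uf pg pg1 pg2 B mB; rewrite pg// pg1// pg2//.
have u1 := unit_valuedM ug uf; have u2 := unit_valuedM ug (unit_valuedB uf).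
rewrite -ge0_integralD//.
- by apply: eq_integral => x _; rewrite -EFinD -mulrDr addrC subrK mulr1.
- by move=> x _; rewrite lee_fin; have /andP[] := u1.2 x.
- apply: measurable_funTS; apply/measurable_EFinP.
  exact: (unit_valued_measurable u1).
- by move=> x _; rewrite lee_fin; have /andP[] := u2.2 x.
- apply: measurable_funTS; apply/measurable_EFinP.
  exact: (unit_valued_measurable u2).
Qed.

Lemma mass_split p p1 p2 : (forall B, measurable B -> (p1 B + p2 B = p B)%E) ->
  mass p = mass p1 + mass p2.
Proof.
by move=> h; rewrite /mass -h// fineD// fin_num_measure.
Qed.

Lemma ball_borel (t : R) x : (measurable : set (set (borel X')))
  [set y | dist_pi d x y < t].
Proof. by apply: open_borel; exact: open_ball_dist_pi. Qed.

Lemma tent_density_support mu g t x p : 0 < t ->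
  is_density mu (fun y => g y * tent t x y) p ->
  p (~` [set y | dist_pi d x y < t]) = 0%E.
Proof.
move=> t0 pg; have mS := ball_borel t x.
rewrite pg; last exact: measurableC.
apply: integral0_eq => y /negP; rewrite -leNgt => ty.
by rewrite tent0// mulr0.
Qed.

Section plan_partition.
Variables (t k : R).
Hypotheses (t0 : 0 < t) (k0 : 0 <= k).
Hypothesis tk : forall u : R, 0 <= u < 2 * t -> 1 - cos u <= k.

Let ball_cos x (y z : X) : dist_pi d x y < t -> dist_pi d x z < t ->
  1 - cos (dist_pi d y z) <= k.
Proof.
move=> xy xz; apply: tk; rewrite dist_pi_ge0//=.
by have := dist_pi_triangle dm y x z; rewrite (dist_pi_sym dm y x); lra.
Qed.

Definition int_close mu nu (delta : R) : pred (X' -> R) :=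
  fun f => `|\int[mu]_x f x - \int[nu]_x f x| <= delta.

(** The pieces around the points of [l] are matched by [plan_local] with a small
[k], and the leftovers with [k = 2], which is valid on the whole space since
[cos] is at least [- 1]. *)
Lemma plan_partition mu nu (delta : R) l g p q : unit_valued g ->
  all (int_close mu nu delta) (pieces t g l) ->
  is_density mu g p -> is_density nu g q ->
  plan p q ((size l).+1%:R * delta + k * (mass p + mass q)
    + 2 * (\int[mu]_x leftover t g l x + \int[nu]_x leftover t g l x)).
Proof.
elim: l g p q => [|x l IH] g p q ug /=.
  rewrite andbT => cl pg qg.
  have cos2 (x y : X) : [set: borel X'] x -> [set: borel X'] y ->
    1 - cos (dist_pi d x y) <= 2 by have := cos_geN1 (dist_pi d x y); lra.
  have vT (r : M) : r (~` setT) = 0%E by rewrite setCT measure0.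
  have := plan_local dm s_dense measurableT (vT p) (vT q) (ler0n _ 2) cos2.
  apply: plan_le; rewrite mul1r; move: cl; rewrite /int_close.
  rewrite -(density_mass pg) -(density_mass qg) => cl.
  by rewrite lerD2r -[leLHS]addr0 lerD// mulr_ge0// addr_ge0// mass_ge0.
move=> /andP[cl cls] pg qg.
have ut := tent_unit_valued t x.
have ug1 := unit_valuedM ug ut.
have ug2 := unit_valuedM ug (unit_valuedB ut).
have [p1 pg1] := ex_density mu ug1; have [p2 pg2] := ex_density mu ug2.
have [q1 qg1] := ex_density nu ug1; have [q2 qg2] := ex_density nu ug2.
have ps := density_split ug ut pg pg1 pg2.
have qs := density_split ug ut qg qg1 qg2.
have pl2 := IH _ _ _ ug2 cls pg2 qg2.
have pl1 := plan_local dm s_dense (ball_borel t x)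
  (tent_density_support t0 pg1) (tent_density_support t0 qg1) k0 (@ball_cos x).
have := plan_add dm s_dense pl1 pl2.
move/(plan_eq ps qs); apply: plan_le.
rewrite (mass_split ps) (mass_split qs).
move: cl; rewrite /int_close -(density_mass pg1) -(density_mass qg1) => cl.
rewrite -[(size l).+2]addn1 natrD.
by move: (`|_|) cl (_.+1%:R) => u cl v; lra.
Qed.

End plan_partition.
End partition.
Arguments leftover {R X} d t g l.
Arguments pieces {R X} d t g l.

(** * From narrow closeness to small cost *)

Section approximation.
Context (R : realType) (X : pointedType) (d : X -> X -> \bar R).
Hypothesis dm : extended_metric d.
Variable s : nat -> X.
Hypothesis s_dense : forall x (e : R), 0 < e -> exists k, dist_pi d (s k) x < e.
Local Notation X' := (dspace d).
Local Notation M := (radon_measure R X').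
Implicit Types (mu nu p q : M) (f g : X' -> R).

Let hX : hausdorff_space X' := dspace_hausdorff dm.

Lemma cos_near1 (k : R) : 0 < k ->
  exists2 t, 0 < t & forall u : R, 0 <= u < 2 * t -> 1 - cos u <= k.
Proof.
move=> k0; have /cvgrPdist_lt/(_ _ k0)/nbhs_ballP[t /= t0 tk] :=
  @continuous_cos R 0.
exists (t / 2); first by rewrite divr_gt0.
move=> u /andP[u0]; rewrite mulrC divfK// => ut.
have := tk u; rewrite /ball/= sub0r normrN ger0_norm// => /(_ ut).
by rewrite cos0 => /ltW; apply: le_trans; exact: ler_norm.
Qed.

(** Up to mass [e], [mu] is carried by a compact set; finitely many balls of
radius [t / 2] around points of the dense sequence cover it, and the leftover
vanishes on them. *)
Lemma leftover_small mu (t e : R) : 0 < t -> 0 < e -> exists N,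
  \int[mu]_x leftover d t (fun=> 1) (map s (iota 0 N)) x <= e.
Proof.
move=> t0 e0; have t20 : 0 < t / 2 by rewrite divr_gt0.
have [K [cK mK _ Ke]] := radon_val_regular mu measurableT e0.
have /compact_near_coveringP/(_ _ (@nbhs nat _ \oo)
  (fun N x => exists2 k, (k < N)%N & dist_pi d (s k) x < t / 2)) := cK.
move=> [].
  move=> x _; have [k kx] := s_dense x t20.
  exists ([set y | dist_pi d (s k) y < t / 2], [set N | (k < N)%N]).
    split; last by exists k.+1.
    by apply: open_nbhs_nbhs; split => //; exact: open_ball_dist_pi.
  by move=> [y N] [/= ky kN]; exists k.
move=> N _ /(_ N (leqnn N)) KN; exists N.
set h := leftover _ _ _ _.
have uh : unit_valued h by apply: leftover_unit_valued => //; exact: unit_valued1.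
have [p ph] := ex_density dm mu uh.
rewrite -(density_mass ph) -lee_fin massE ph//.
apply: le_trans Ke.
have mC := measurableC mK.
rewrite setTD -(setIT (~` K)) -integral_indic//.
apply: ge0_le_integral => //.
- by move=> x _; rewrite lee_fin; have /andP[] := uh.2 x.
- by apply/measurable_EFinP; exact: (unit_valued_measurable uh).
- exact/measurable_EFinP/measurable_indic.
- move=> x _; rewrite lee_fin indicE.
  have [Kx|Kx] := pselect (K x); last first.
    by rewrite mem_set//; have /andP[] := uh.2 x.
  have [k kN kx] := KN x Kx.
  rewrite /h leftover0//; exists (s k) => //.
  by apply: map_f; rewrite mem_iota.
Qed.

Section near.
Variables (F : set_system M) (mu : M).
Context {FF : Filter F}.
Hypothesis Fmu : forall phi : X' -> R, continuous phi -> bounded_fun phi ->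
  (fun nu : M => \int[nu]_x phi x) @ F --> \int[mu]_x phi x.

Let near_close f (delta : R) : unit_valued f -> 0 < delta ->
  \forall nu \near F, int_close mu nu delta f.
Proof.
move=> uf d0; have bf := unit_valued_bounded uf.
by have /cvgrPdist_le/(_ _ d0) := Fmu uf.1 bf.
Qed.

Let near_pieces (t : R) g l (delta : R) : unit_valued g -> 0 < delta -> 0 < t ->
  \forall nu \near F, all (int_close mu nu delta) (pieces d t g l).
Proof.
move=> + d0 t0; elim: l g => [|x l IH] g ug /=.
  by apply: filterS (near_close ug d0) => nu; rewrite andbT.
have ut := tent_unit_valued dm t x.
have h1 := near_close (unit_valuedM ug ut) d0.
have h2 := IH _ (unit_valuedM ug (unit_valuedB ut)).
by apply: filterS2 h1 h2 => nu c1 c2; apply/andP; split.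
Qed.

(** With [E = e ^+ 2], the bound of [plan_partition] splits into three terms. The
differences of the [N.+1] pieces contribute at most [N.+1%:R * delta], the angles
at most [E / 4] by the choice of [k], and the leftovers at most four times
[E / 16] plus [2 * delta]. *)
Lemma HK_near (e : R) : 0 < e -> \forall nu \near F, (HK d mu nu < e%:E)%E.
Proof.
move=> e0; pose E := e ^+ 2; have E0 : 0 < E by rewrite exprn_gt0.
have m0 := mass_ge0 mu.
pose k := E / 4 / (2 * mass mu + 1).
have m1 : 0 < 2 * mass mu + 1 by lra.
have k0 : 0 < k by rewrite !divr_gt0.
have [t t0 tk] := cos_near1 k0.
have E16 : 0 < E / 16 by rewrite divr_gt0.
have [N hN] := leftover_small mu t0 E16.
pose l := map s (iota 0 N).
pose delta := Num.min 1 (E / 8 / (N.+3)%:R).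
have d0 : 0 < delta by rewrite lt_min ltr01 !divr_gt0.
have d1 : delta <= 1 by rewrite ge_min lexx.
have dN : (N.+3)%:R * delta <= E / 8.
  by rewrite mulrC -ler_pdivlMr// ge_min lexx orbT.
have u1 := unit_valued1 d.
have ul := leftover_unit_valued dm t l u1.
apply: filterS3 (near_pieces l u1 d0 t0) (near_close u1 d0) (near_close ul d0).
move=> nu cp c1 cl; apply: (proj2 (HK_lt mu nu e0)).
have := plan_partition dm s_dense t0 (ltW k0) tk u1 cp
  (density1 mu) (density1 nu).
set c := (X in plan _ _ X) => pl; exists c => //; rewrite /c -/E.
rewrite size_map size_iota.
move: c1 cl hN; rewrite /int_close -(density_mass (density1 mu)).
rewrite -(density_mass (density1 nu)) -/l.
move: (\int[mu]_x leftover _ _ _ _ x) (\int[nu]_x leftover _ _ _ _ x) => a b.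
rewrite !ler_norml => /andP[c1 c2] /andP[c3 c4] aE.
have kE : k * (2 * mass mu + 1) = E / 4 by rewrite /k divfK// gt_eqF.
have kd : k * (mass mu + mass nu) <= E / 4.
  by rewrite -kE; apply: ler_wpM2l; [exact: ltW|lra].
have : (N.+3)%:R * delta = N.+1%:R * delta + 2 * delta.
  by rewrite -[N.+3]addn2 natrD mulrDl.
move: (N.+3%:R * delta) (N.+1%:R * delta) dN => u v; lra.
Qed.

End near.

Lemma radon_discrete (l : seq (nat * R)) : all (fun i => 0 <= i.2) l ->
  exists nu : M, forall B, measurable B ->
  nu B = (\sum_(i <- l) i.2%:E * \d_(s i.1 : borel X') B)%E.
Proof.
elim: l => [_|[k r] l IH /= /andP[r0 /IH[nu nuE]]].
  have [nu nuE] := radon_dirac (NngNum (lexx (0 : R))) (point : X') hX.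
  by exists nu => B mB; rewrite nuE/= mul0e big_nil.
have [nu' nu'E] := radon_dirac (NngNum r0) (s k : X') hX.
have [rho rhoE] := radon_add nu' nu hX.
by exists rho => B mB; rewrite rhoE nuE// nu'E big_cons.
Qed.

(** Indices into the dense sequence and rational weights form a countable type,
which makes the chosen measures a countable set; the absolute value makes every
list admissible. *)
Definition discrete (l : seq (nat * rat)) nu := forall B, measurable B ->
  nu B = (\sum_(i <- l) `|ratr i.2|%:E * \d_(s i.1 : borel X') B)%E.

Lemma ex_discrete l : exists nu, discrete l nu.
Proof.
have [|nu nuE] := @radon_discrete (map (fun i => (i.1, `|ratr i.2|)) l).
  by rewrite all_map; apply/allP => i _ /=.
by exists nu => B mB; rewrite nuE// big_map.
Qed.

(** The piece of [mu] around [s x] is matched with the multiple of the Dirac mass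
at [s x] whose weight is a rational number within [delta] above the mass of the
piece; the leftover is sent to the vertex. *)
Lemma plan_discrete mu (t k delta : R) (N : seq nat) g p :
  0 < t -> 0 <= k -> (forall u : R, 0 <= u < 2 * t -> 1 - cos u <= k) ->
  0 < delta -> unit_valued g -> is_density mu g p ->
  exists l : seq (nat * rat), forall nu, discrete l nu ->
    plan p nu ((size N)%:R * delta + k * (2 * mass p + (size N)%:R * delta)
     + \int[mu]_x leftover d t g (map s N) x).
Proof.
move=> t0 k0 tk d0; elim: N g p => [|x N IH] g p ug pg /=.
  exists [::] => nu nuE.
  have nu0 : mass nu = 0 by rewrite /mass nuE// big_nil.
  apply: plan_le (plan_vanish dm s_dense p nu0).
  rewrite -(density_mass pg) !mul0r add0r addr0 lerDr mulr_ge0// mulr_ge0//.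
  exact: mass_ge0.
have ut := tent_unit_valued dm t (s x).
have ug1 := unit_valuedM ug ut.
have ug2 := unit_valuedM ug (unit_valuedB ut).
have [p1 pg1] := ex_density dm mu ug1; have [p2 pg2] := ex_density dm mu ug2.
have ps := density_split ug ut pg pg1 pg2.
have [l lE] := IH _ _ ug2 pg2.
have [q] : exists q : rat, ratr q \in `](mass p1), (mass p1 + delta)[.
  by apply: rat_in_itvoo; rewrite ltrDl.
rewrite in_itv/= => /andP[q1 q2].
have q0 : 0 <= ratr q :> R by apply: le_trans (ltW q1); exact: mass_ge0.
exists ((x, q) :: l) => nu nuE.
have [nu2 nu2E] := ex_discrete l.
have [nu1 nu1E] := radon_dirac (NngNum q0) (s x : X') hX.
have mnu1 : mass nu1 = ratr q by rewrite /mass nu1E diracT mule1.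
have sup : nu1 (~` [set y | dist_pi d (s x) y < t]) = 0%E.
  rewrite nu1E diracE memNset ?mule0// => h; apply: h.
  by rewrite /= dist_pi_xx.
have bc y z : dist_pi d (s x) y < t -> dist_pi d (s x) z < t ->
    1 - cos (dist_pi d y z) <= k.
  move=> xy xz; apply: tk; rewrite dist_pi_ge0//=.
  by have := dist_pi_triangle dm y (s x) z; rewrite (dist_pi_sym dm y (s x)); lra.
have pl1 := plan_local dm s_dense (ball_borel dm t (s x))
  (tent_density_support dm t0 pg1) sup k0 bc.
have := plan_add dm s_dense pl1 (lE _ nu2E).
have nus B : measurable B -> (nu1 B + nu2 B = nu B)%E.
  by move=> mB; rewrite nuE// big_cons nu1E nu2E//= ger0_norm.
move/(plan_eq ps nus); apply: plan_le.
rewrite (mass_split ps) mnu1.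
rewrite ler0_norm ?subr_le0 ?ltW// -[(size N).+1]addn1 natrD.
have kd : k * ratr q <= k * (mass p1 + delta) by rewrite ler_wpM2l// ltW.
move: kd q2; move: (ratr q : R) ((size N)%:R : R) => r n kd q2.
lra.
Qed.

Lemma HK_discrete mu (e : R) : 0 < e ->
  exists l, forall nu, discrete l nu -> (HK d mu nu < e%:E)%E.
Proof.
move=> e0; pose E := e ^+ 2; have E0 : 0 < E by rewrite exprn_gt0.
have m0 := mass_ge0 mu.
pose k := E / 4 / (2 * mass mu + 1).
have m1 : 0 < 2 * mass mu + 1 by lra.
have k0 : 0 < k by rewrite !divr_gt0.
have [t t0 tk] := cos_near1 k0.
have E4 : 0 < E / 4 by rewrite divr_gt0.
have [N hN] := leftover_small mu t0 E4.
pose delta := Num.min 1 (E / 4) / N.+1%:R.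
have d0 : 0 < delta by rewrite divr_gt0// lt_min ltr01 E4.
have dN : N%:R * delta <= Num.min 1 (E / 4).
  rewrite mulrC /delta mulrAC ler_pdivrMr//.
  by rewrite ler_wpM2l ?le_min ?ler01 ?ltW// ltr_nat.
move: dN; rewrite le_min => /andP[dN1 dNE].
have u1 := unit_valued1 d.
have [l lE] := plan_discrete (iota 0 N) t0 (ltW k0) tk d0 u1 (density1 mu).
exists l => nu /lE pl; apply: (proj2 (HK_lt mu nu e0)).
eexists; last exact: pl.
rewrite size_iota -/E.
have kE : k * (2 * mass mu + 1) = E / 4 by rewrite /k divfK// gt_eqF.
have kd : k * (2 * mass mu + N%:R * delta) <= E / 4.
  by rewrite -kE; apply: ler_wpM2l; [exact: ltW|lra].
lra.
Qed.

Lemma HK_separable : exists2 D : set M, countable D &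
  forall mu (e : R), 0 < e -> exists2 nu, D nu & (HK d mu nu < e%:E)%E.
Proof.
have /choice[D DE] := ex_discrete.
exists (range D); first exact: card_le_trans (card_image_le D setT) (countableP _).
move=> mu e /(HK_discrete mu)[l lE]; exists (D l); first by exists l.
exact: lE.
Qed.

End approximation.

(** * From small cost to narrow closeness *)

Section weighted_pushforward.
Context d1 d2 (Y : measurableType d1) (Z : measurableType d2) (R : realType).
Local Open Scope ereal_scope.
Variables (a : {measure set Y -> \bar R}) (m : {measure set Z -> \bar R}).
Variables (T : Y -> Z) (w : Y -> R).
Hypotheses (mT : measurable_fun setT T) (mw : measurable_fun setT w).
Hypothesis w0 : forall y, (0 <= w y)%R.
Hypothesis mE : forall B, measurable B -> m B = \int[a]_(y in T @^-1` B) (w y)%:E.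
Let mwE : measurable_fun setT (fun y => (w y)%:E).
Proof. exact/measurable_EFinP. Qed.
Import HBNNSimple.

Let weighted_nnsfun (h : {nnsfun Z >-> R}) :
  \int[m]_z (h z)%:E = \int[a]_y ((h (T y))%:E * (w y)%:E).
Proof.
have mhT r : measurable (T @^-1` (h @^-1` [set r])).
  by rewrite -[X in measurable X]setTI; exact: mT.
rewrite integralT_nnsfun sintegralE.
transitivity (\sum_(r \in range h)
    \int[a]_y (r%:E * ((\1_(T @^-1` (h @^-1` [set r])) y)%:E * (w y)%:E))).
  apply: eq_fsbigr => r rh; rewrite ge0_integralZl//.
  - congr (_ * _); rewrite mE// integral_mkcond.
    by apply: eq_integral => y _; rewrite epatch_indic muleC.
  - by apply: emeasurable_funM => //; exact/measurable_EFinP/measurable_indic.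
  - by move=> y _; rewrite mule_ge0 ?lee_fin.
  - by move: rh; rewrite inE => -[z _ <-]; rewrite lee_fin.
rewrite -ge0_integral_fsum//.
- apply: eq_integral => y _; rewrite (fimfunE h) -fsumEFin//.
  rewrite ge0_mule_fsuml//.
    by apply: eq_fsbigr => r _; rewrite muleA.
  by move=> r; rewrite EFinM; exact: nnfun_muleindic_ge0.
- move=> r; apply: emeasurable_funM => //; apply: emeasurable_funM => //.
  exact/measurable_EFinP/measurable_indic.
- move=> r y _; rewrite muleA mule_ge0 ?lee_fin//.
  rewrite -lee_fin EFinM.
  exact: nnfun_muleindic_ge0.
Qed.

(** Change of variables for the image of a measure with density; it holds for
simple functions by the hypothesis on [m], and monotone convergence extends
it. *)
Lemma ge0_integral_weighted_pushforward (f : Z -> \bar R) :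
  measurable_fun setT f -> (forall z, 0 <= f z) ->
  \int[m]_z f z = \int[a]_y (f (T y) * (w y)%:E).
Proof.
move=> mf f0.
pose f_ := nnsfun_approx measurableT mf.
have fcvg z : (f_ n z)%:E @[n --> \oo] --> f z.
  by apply: cvg_nnsfun_approx.
have mfT n : measurable_fun setT (fun y => (f_ n (T y))%:E).
  by apply/measurable_EFinP; exact: measurableT_comp.
transitivity (limn (fun n => \int[m]_z (f_ n z)%:E)).
  rewrite -monotone_convergence//.
  - by apply: eq_integral => z _; apply/esym/cvg_lim.
  - by move=> n; exact/measurable_EFinP.
  - by move=> n z _; rewrite lee_fin.
  - by move=> z _ i j ij; rewrite lee_fin; exact/lefP/nd_nnsfun_approx.
under eq_fun do rewrite weighted_nnsfun.
rewrite -monotone_convergence//.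
- apply: eq_integral => y _; apply/cvg_lim => //.
  by apply: cvgeZr => //; exact: fcvg.
- by move=> n; exact: emeasurable_funM.
- by move=> n y _; rewrite mule_ge0 ?lee_fin.
- move=> y _ i j ij; apply: lee_wpmul2r; first by rewrite lee_fin.
  by rewrite lee_fin; exact/lefP/nd_nnsfun_approx.
Qed.

End weighted_pushforward.

Lemma ge0_integral_lincomb3 dY (Y : measurableType dY) (R : realType)
    (m : {measure set Y -> \bar R}) (f g h : Y -> R) (a b c : R) :
  measurable_fun setT f -> measurable_fun setT g -> measurable_fun setT h ->
  (forall y, 0 <= f y) -> (forall y, 0 <= g y) -> (forall y, 0 <= h y) ->
  0 <= a -> 0 <= b -> 0 <= c ->
  (\int[m]_y (a * f y + b * g y + c * h y)%:E =
   a%:E * \int[m]_y (f y)%:E + b%:E * \int[m]_y (g y)%:E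
   + c%:E * \int[m]_y (h y)%:E)%E.
Proof.
move=> mf mg mh f0 g0 h0 a0 b0 c0.
have mE (k : Y -> R) : measurable_fun setT k ->
    measurable_fun setT (fun y => (k y)%:E) by move=> ?; exact/measurable_EFinP.
have mZ (k : Y -> R) r : measurable_fun setT k ->
    measurable_fun setT (fun y => (r * k y)%:E).
  by move=> mk; apply: mE; exact: measurable_funM.
have iZ (k : Y -> R) r : measurable_fun setT k -> (forall y, 0 <= k y) ->
    0 <= r -> (\int[m]_y (r * k y)%:E = r%:E * \int[m]_y (k y)%:E)%E.
  move=> mk k0 r0; rewrite -ge0_integralZl_EFin//; last exact: mE.
  by move=> y _; rewrite lee_fin.
have Z0 (k : Y -> R) r y : (forall y, 0 <= k y) -> 0 <= r ->
    (0 <= (r * k y)%:E)%E by move=> k0 r0; rewrite lee_fin mulr_ge0.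
rewrite -!iZ//.
rewrite -(ge0_integralD m measurableT) => [|y _||y _|]; try exact: mZ; try exact: Z0.
rewrite -(ge0_integralD m measurableT) => [|y _||y _|]; try exact: mZ; try exact: Z0.
- by [].
- by apply: adde_ge0; exact: Z0.
- by apply: emeasurable_funD; exact: mZ.
Qed.

Section lower_bound.
Context (R : realType) (X : pointedType) (d : X -> X -> \bar R).
Hypothesis dm : extended_metric d.
Variable s : nat -> X.
Hypothesis s_dense : forall x (e : R), 0 < e -> exists k, dist_pi d (s k) x < e.
Local Notation X' := (dspace d).
Local Notation M := (radon_measure R X').
Local Notation C := (cone_space d).
Local Notation CC := (C * C)%type.

Lemma integral_hmarginal (mu : M) (alpha : radon_measure R CC) (pr : CC -> C)
    (f : X' -> R) : continuous pr ->
  (forall B, measurable B -> hmarginal pr alpha B = mu B) ->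
  measurable_fun [set: borel X'] (f : borel X' -> R) -> (forall x, 0 <= f x) ->
  (\int[mu]_x (f x)%:E =
   \int[alpha]_z (f (cone_x (pr z)) * cone_r (pr z) ^+ 2)%:E)%E.
Proof.
move=> cpr muE mf f0.
rewrite (ge0_integral_weighted_pushforward (a := alpha)
  (T := (fun z : borel CC => cone_x (pr z) : borel X'))
  (w := (fun z : borel CC => cone_r (pr z) ^+ 2))).
- by apply: eq_integral => z _; rewrite EFinM.
- exact: measurable_pr_cone_x.
- by apply: measurable_funX; exact: measurable_pr_cone_r.
- by move=> z; exact: sqr_ge0.
- by move=> B mB; exact: (esym (muE _ mB)).
- exact/measurable_EFinP.
- by move=> z; rewrite lee_fin.
Qed.

(** Only [x] is confined to [K]: the second point of a plan may be anywhere near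
the first one. *)
Lemma compact_uniform_continuity (K : set X') (phi : X' -> R) (e : R) :
  compact K -> continuous phi -> 0 < e ->
  exists2 t : R, 0 < t <= pi / 2 & forall x y, K x ->
    dist_pi d x y < t -> `|phi x - phi y| <= e.
Proof.
move=> cK cphi e0; have e20 : 0 < e / 2 by rewrite divr_gt0.
move: cK => /compact_near_coveringP/(_ _ (@nbhs nat _ \oo)
  (fun N x => forall y, dist_pi d x y < N.+1%:R^-1 -> `|phi x - phi y| <= e)).
move=> [].
  move=> x _.
  have /(dspace_nbhsP dm)[r r0 rphi] : nbhs x [set y | `|phi x - phi y| < e / 2].
    have /(cvgrPdist_lt (FF := @nbhs_filter X' x)) := cphi x.
    by apply.
  have r20 : 0 < r / 2 by rewrite divr_gt0.
  have /cvgrPdist_lt/(_ _ r20) := @cvg_harmonic R => hr.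
  exists ([set y | dist_pi d x y < r / 2], [set N | `|0 - N.+1%:R^-1| < r / 2]).
    by split => //=; exact: near_dist_pi.
  move=> [y N] [/= xy]; rewrite sub0r normrN ger0_norm// => Nr z yz.
  have xz : dist_pi d x z < r.
    have := dist_pi_triangle dm x y z.
    by move: (N.+1%:R^-1) Nr yz => u Nr yz; lra.
  have xy' : dist_pi d x y < r by lra.
  have := rphi _ xz; have := rphi _ xy' => /=.
  rewrite !ltr_norml => /andP[h1 h2] /andP[h3 h4].
  by rewrite ler_norml; apply/andP; split; lra.
move=> N _ /(_ N (leqnn N)) KN.
exists (Order.min N.+1%:R^-1 (pi / 2)).
  by rewrite lt_min ge_min lexx orbT invr_gt0 ltr0n divr_gt0 ?pi_gt0.
by move=> x y Kx; rewrite lt_min => /andP[xy _]; exact: KN.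
Qed.

(** The integrand is split as [(a - b) * r ^+ 2 + b * (r ^+ 2 - v ^+ 2)], where
[a], [b] are the values of [phi] and [r], [v] the radii. The second term is
estimated by the arithmetic-geometric inequality with weight [u]. For the first
one, either [x] is outside [K], or the angle is below [t] and [`|a - b| <= e],
or the angle is at least [t] and [r ^+ 2 * sin t ^+ 2] is at most the squared
cone distance. *)
Lemma cone_test_estimate (K : set X') (phi : X' -> R) (k e t u : R) (p q : C) :
  (forall x, 0 <= phi x <= k) -> 0 <= e -> 0 < u -> 0 < t <= pi / 2 ->
  (forall x y, K x -> dist_pi d x y < t -> `|phi x - phi y| <= e) ->
  `|phi (cone_x p) * cone_r p ^+ 2 - phi (cone_x q) * cone_r q ^+ 2| <=
  (k * (1 + u^-1) + k / sin t ^+ 2) * cone_dist d p q ^+ 2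
  + (k * u + e) * cone_r p ^+ 2 + k * (\1_(~` K) (cone_x p) * cone_r p ^+ 2).
Proof.
move=> phik e0 u0 /andP[t0 tpi] Kphi.
have p0 := pi_gt0 R.
have st0 : 0 < sin t ^+ 2 by rewrite exprn_gt0// sin_gt0_pi// t0/=; lra.
have k0 : 0 <= k by have /andP[] := phik point; apply: le_trans.
have r0 := cone_r_ge0 p; have v0 := cone_r_ge0 q.
have rD := cone_r_sqr_le d p q.
set D := cone_dist d p q ^+ 2 in rD *.
have D0 : 0 <= D by exact: sqr_ge0.
set r := cone_r p in r0 rD *; set v := cone_r q in v0 rD *.
set a := phi (cone_x p); set b := phi (cone_x q).
have /andP[a0 ak] : 0 <= a <= k by exact: phik.
have /andP[b0 bk] : 0 <= b <= k by exact: phik.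
have h1 : `|r ^+ 2 - v ^+ 2| <= (1 + u^-1) * D + u * r ^+ 2.
  have -> : r ^+ 2 - v ^+ 2 = (r - v) * (2 * r - (r - v)) by ring.
  rewrite normrM; set x := `|r - v|.
  have xD : x ^+ 2 <= D by rewrite real_normK ?num_real.
  have x0 : 0 <= x by exact: normr_ge0.
  apply: (@le_trans _ _ (x * (2 * r + x))).
    rewrite ler_wpM2l// (le_trans (ler_normB _ _))// lerD2r.
    by rewrite ger0_norm// mulr_ge0.
  have : 0 <= u * (r - x / u) ^+ 2 by rewrite mulr_ge0 ?sqr_ge0// ltW.
  have -> : u * (r - x / u) ^+ 2 = u * r ^+ 2 - 2 * r * x + u^-1 * x ^+ 2.
    by field; rewrite gt_eqF.
  have : u^-1 * x ^+ 2 <= u^-1 * D by rewrite ler_wpM2l// invr_ge0 ltW.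
  by rewrite mulrDl mul1r mulrDr -expr2; lra.
have h2 : `|a - b| * r ^+ 2 <= e * r ^+ 2 + k * (\1_(~` K) (cone_x p) * r ^+ 2)
    + k / sin t ^+ 2 * D.
  have abk : `|a - b| <= k by rewrite ler_norml; apply/andP; split; lra.
  have r20 : 0 <= r ^+ 2 by exact: sqr_ge0.
  have e1 : 0 <= e * r ^+ 2 by exact: mulr_ge0.
  have ks : 0 <= k / sin t ^+ 2 by rewrite divr_ge0// ltW.
  have e2 : 0 <= k / sin t ^+ 2 * D by exact: mulr_ge0.
  have [Kp|nKp] := pselect (K (cone_x p)); last first.
    rewrite indicE mem_set// mul1r.
    have : `|a - b| * r ^+ 2 <= k * r ^+ 2 by exact: ler_wpM2r.
    lra.
  rewrite indicE memNset ?mul0r ?mulr0 ?addr0//.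
  have [pq|pq] := ltP (dist_pi d (cone_x p) (cone_x q)) t.
    have : `|a - b| * r ^+ 2 <= e * r ^+ 2 by apply: ler_wpM2r => //; exact: Kphi.
    lra.
  have := cone_dist_angle dm (t := t) _ pq; rewrite (ltW t0) tpi => /(_ isT) rs.
  have : `|a - b| * r ^+ 2 <= k * r ^+ 2 by exact: ler_wpM2r.
  have : k / sin t ^+ 2 * (r ^+ 2 * sin t ^+ 2) <= k / sin t ^+ 2 * D.
    exact: ler_wpM2l.
  have -> : k / sin t ^+ 2 * (r ^+ 2 * sin t ^+ 2) = k * r ^+ 2.
    by field; rewrite gt_eqF// sin_gt0_pi// t0/=; lra.
  lra.
have -> : a * r ^+ 2 - b * v ^+ 2 = (a - b) * r ^+ 2 + b * (r ^+ 2 - v ^+ 2).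
  by ring.
apply: (le_trans (ler_normD _ _)); rewrite (normrM (a - b)) (normrM b) (ger0_norm b0).
rewrite (ger0_norm (sqr_ge0 r)).
have h3 : b * `|r ^+ 2 - v ^+ 2| <= k * ((1 + u^-1) * D + u * r ^+ 2).
  by apply: ler_pM.
move: h2 h3; move: (`|_| * _) (b * _) => A B h2 h3.
have -> : (k * (1 + u^-1) + k / sin t ^+ 2) * D + (k * u + e) * r ^+ 2 +
   k * (\1_(~` K) (cone_x p) * r ^+ 2) =
   (e * r ^+ 2 + k * (\1_(~` K) (cone_x p) * r ^+ 2) + k / sin t ^+ 2 * D) +
   k * ((1 + u^-1) * D + u * r ^+ 2) by ring.
exact: lerD.
Qed.

(** The threshold [c0] depends on [mu] but not on [nu]: in [cone_test_estimate]
only the first radius appears besides the cone distance. *)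
Lemma plan_test_estimate (mu : M) (phi : X' -> R) (k e : R) :
  continuous phi -> (forall x, 0 <= phi x <= k) -> 0 < k -> 0 < e ->
  exists2 c0 : R, 0 < c0 & forall (nu : M) c, plan mu nu c -> c < c0 ->
    `|\int[mu]_x phi x - \int[nu]_x phi x| <= e.
Proof.
move=> cphi phik k0 e0; have m0 := mass_ge0 mu.
have m1 : 0 < mass mu + 1 by lra.
(* With [k * u = e1], the term in [r1 ^+ 2] integrates to [2 * e1 * mass mu], at
   most [e / 2]; the cost and the mass outside [K] account for [e / 4] each. *)
pose u := e / 4 / (mass mu + 1) / k.
pose e1 := e / 4 / (mass mu + 1).
have e10 : 0 < e1 by rewrite !divr_gt0.
have u0 : 0 < u by rewrite !divr_gt0.
have e4k : 0 < e / 4 / k by rewrite !divr_gt0.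
have [K [cK mK _ Ke]] := radon_val_regular mu measurableT e4k.
have [t tpi Kphi] := compact_uniform_continuity cK cphi e10.
have p0 := pi_gt0 R.
have st0 : 0 < sin t ^+ 2.
  by rewrite exprn_gt0// sin_gt0_pi//; case/andP: tpi => -> /=; lra.
pose A := k * (1 + u^-1) + k / sin t ^+ 2.
have A0 : 0 < A.
  by rewrite addr_gt0// ?divr_gt0// mulr_gt0// addr_gt0// invr_gt0.
exists (e / 4 / A); first by rewrite !divr_gt0.
move=> nu c [alpha [a1 a2 ac]] cA.
have mphi := continuous_borel_real cphi.
have phi0 x : 0 <= phi x by have /andP[] := phik x.
pose G1 (z : borel CC) := phi (cone_x z.1) * cone_r z.1 ^+ 2.
pose G2 (z : borel CC) := phi (cone_x z.2) * cone_r z.2 ^+ 2.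
have I1 : (\int[mu]_x (phi x)%:E = \int[alpha]_z (G1 z)%:E)%E.
  exact: integral_hmarginal (@continuous_fst _ _) a1 mphi phi0.
have I2 : (\int[nu]_x (phi x)%:E = \int[alpha]_z (G2 z)%:E)%E.
  exact: integral_hmarginal (@continuous_snd _ _) a2 mphi phi0.
have G10 z : 0 <= G1 z by rewrite mulr_ge0 ?sqr_ge0.
have G20 z : 0 <= G2 z by rewrite mulr_ge0 ?sqr_ge0.
pose B (z : borel CC) := A * cone_dist d z.1 z.2 ^+ 2 +
  (k * u + e1) * cone_r z.1 ^+ 2 + k * (\1_(~` K) (cone_x z.1) * cone_r z.1 ^+ 2).
have GB z : `|G1 z - G2 z| <= B z.
  by apply: (cone_test_estimate _ _ phik (ltW e10) u0 tpi Kphi).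
have mr1 := measurable_pr_cone_r (@continuous_fst C C).
have mr2 := measurable_pr_cone_r (@continuous_snd C C).
have mx1 := measurable_pr_cone_x dm (@continuous_fst C C).
have mx2 := measurable_pr_cone_x dm (@continuous_snd C C).
have mr12 : measurable_fun setT (fun z : borel CC => cone_r z.1 ^+ 2).
  exact: measurable_funX.
have mG1 : measurable_fun setT G1.
  by apply: measurable_funM => //; exact: (measurableT_comp mphi mx1).
have mG2 : measurable_fun setT G2.
  apply: measurable_funM; last exact: measurable_funX.
  exact: (measurableT_comp mphi mx2).
have mCK := measurableC mK.
have mI : measurable_fun [set: borel X'] (\1_(~` K) : borel X' -> R).
  exact: measurable_indic.
have mIK : measurable_fun setT
    (fun z : borel CC => \1_(~` K) (cone_x z.1) * cone_r z.1 ^+ 2 : R).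
  by apply: measurable_funM => //; exact: (measurableT_comp mI mx1).
have mD := measurable_cone_dist_sqr dm s_dense.
have I0 x : 0 <= \1_(~` K) x :> R by rewrite indicE ler0n.
have mB : measurable_fun setT B.
  by apply: measurable_funD; first apply: measurable_funD;
    apply: measurable_funM.
have IB : (\int[alpha]_z (B z)%:E <= e%:E)%E.
  have Ic : (\int[alpha]_z (cone_dist d z.1 z.2 ^+ 2)%:E <= c%:E)%E by [].
  have Im : (\int[alpha]_z (cone_r z.1 ^+ 2)%:E = (mass mu)%:E)%E.
    rewrite massE -a1; last exact: measurableT.
    by rewrite /hmarginal /pushforward preimage_setT.
  have IK : (\int[alpha]_z (\1_(~` K) (cone_x z.1) * cone_r z.1 ^+ 2)%:E
      <= (e / 4 / k)%:E)%E.
    rewrite -(integral_hmarginal (@continuous_fst _ _) a1 mI I0).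
    by rewrite integral_indic// setIT -setTD.
  have A0' : 0 <= A by exact: ltW.
  have k0' : 0 <= k by exact: ltW.
  have ku : 0 <= k * u + e1 by rewrite addr_ge0 ?(ltW e10)// mulr_ge0// ltW.
  have i0 (z : borel CC) : 0 <= \1_(~` K) (cone_x z.1) * cone_r z.1 ^+ 2 :> R.
    by rewrite mulr_ge0 ?sqr_ge0.
  rewrite (ge0_integral_lincomb3 alpha mD mr12 mIK (fun z => sqr_ge0 _)
    (fun z => sqr_ge0 _) i0 A0' ku k0').
  rewrite Im.
  apply: (@le_trans _ _ (A%:E * c%:E + (k * u + e1)%:E * (mass mu)%:E +
      k%:E * (e / 4 / k)%:E)%E).
    apply: leeD; [apply: leeD => //|]; apply: lee_wpmul2l => //; rewrite lee_fin//.
  rewrite -!EFinM -!EFinD lee_fin.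
  have -> : k * (e / 4 / k) = e / 4 by field; rewrite gt_eqF.
  have -> : k * u = e1 by rewrite /u /e1; field; rewrite !gt_eqF.
  have Ac : A * c <= e / 4 by rewrite mulrC -ler_pdivlMr// ltW.
  have : e1 * (mass mu + 1) = e / 4 by rewrite /e1 divfK// gt_eqF.
  lra.
have finphi (r : M) : (\int[r]_x (phi x)%:E)%E \is a fin_num.
  rewrite ge0_fin_numE; last by apply: integral_ge0 => x _; rewrite lee_fin.
  apply: (@le_lt_trans _ _ (\int[r]_x (cst k%:E x))%E); last first.
    by rewrite integral_cst// ltey_eq fin_numM// fin_num_measure.
  apply: ge0_le_integral => //.
  - by move=> x _; rewrite lee_fin.
  - exact/measurable_EFinP.
  - by move=> x _; rewrite lee_fin; have /andP[] := phik x.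
have B0 z : 0 <= B z by exact: le_trans (GB z).
have le12 (G H : borel CC -> R) : measurable_fun setT G ->
    measurable_fun setT H -> (forall z, 0 <= G z) -> (forall z, 0 <= H z) ->
    (forall z, G z <= H z + B z) ->
    (\int[alpha]_z (G z)%:E <= \int[alpha]_z (H z)%:E + e%:E)%E.
  move=> mG mH G0 H0 GH; apply: (@le_trans _ _
    (\int[alpha]_z ((H z)%:E + (B z)%:E))%E).
    apply: ge0_le_integral => //.
    - by move=> z _; rewrite lee_fin.
    - exact/measurable_EFinP.
    - by apply: emeasurable_funD; exact/measurable_EFinP.
    - by move=> z _; rewrite -EFinD lee_fin.
  rewrite ge0_integralD//.
  - exact: leeD.
  - by move=> z _; rewrite lee_fin.
  - exact/measurable_EFinP.
  - by move=> z _; rewrite lee_fin.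
  - exact/measurable_EFinP.
have le1 := le12 G1 G2 mG1 mG2 G10 G20.
have le2 := le12 G2 G1 mG2 mG1 G20 G10.
have GB1 z : G1 z <= G2 z + B z.
  by have := GB z; rewrite ler_norml => /andP[_]; rewrite lerBlDl.
have GB2 z : G2 z <= G1 z + B z.
  by have := GB z; rewrite distrC ler_norml => /andP[_]; rewrite lerBlDl.
move: (le1 GB1) (le2 GB2); rewrite -I1 -I2.
rewrite -(fineK (finphi mu)) -(fineK (finphi nu)) -!EFinD !lee_fin.
rewrite -[fine (integral mu _ _)]/(\int[mu]_x phi x).
rewrite -[fine (integral nu _ _)]/(\int[nu]_x phi x).
by move=> h1 h2; rewrite ler_norml; apply/andP; split; lra.
Qed.

End lower_bound.

(** * Comparison of the topologies *)

Lemma ptws_cvgP (I : Type) (V : topologicalType) (F : set_system {ptws I -> V})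
    (g : {ptws I -> V}) : Filter F ->
  F --> g <-> forall i, (fun h : {ptws I -> V} => h i) @ F --> g i.
Proof.
move=> FF; split=> [/cvg_sup Fg i A gA|Fg].
  apply: (Fg i); rewrite nbhsE.
  by move: gA; rewrite nbhsE => -[B [oB Bg] BA]; exists ((fun h => h i) @^-1` B);
    [split => //; exists B|exact: preimage_subset].
apply/cvg_sup => i A /= [_ [[C oC <-] Cg] CA].
rewrite nbhs_filterE; apply: filterS CA _; apply: (Fg i); exact: open_nbhs_nbhs.
Qed.

Section topologies.
Context (R : realType) (X : pointedType) (d : X -> X -> \bar R).
Hypothesis dm : extended_metric d.
Variable s : nat -> X.
Hypothesis s_dense : forall x (e : R), 0 < e -> exists k, dist_pi d (s k) x < e.
Local Notation X' := (dspace d).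
Local Notation M := (radon_measure R X').

Section near.
Variables (F : set_system M) (mu : M).
Context {FF : Filter F}.
Hypothesis Fmu : forall e : R, 0 < e -> \forall nu \near F, (HK d mu nu < e%:E)%E.

Let narrow_near_ge0 (phi : X' -> R) (k : R) : continuous phi ->
  (forall x, 0 <= phi x <= k) -> 0 < k ->
  (fun nu : M => \int[nu]_x phi x) @ F --> \int[mu]_x phi x.
Proof.
move=> cphi phik k0; apply/cvgrPdist_le => /= e e0.
have [c0 c00 c0P] := plan_test_estimate dm s_dense mu cphi phik k0 e0.
have sc0 : 0 < Num.sqrt c0 by rewrite sqrtr_gt0.
apply: filterS (Fmu sc0) => nu /(HK_lt mu nu sc0)[c cc0 pl].
by apply: (c0P nu c pl); rewrite -(sqr_sqrtr (ltW c00)).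
Qed.

(** A bounded function becomes nonnegative after adding a constant, and constants
are themselves nonnegative test functions. *)
Lemma narrow_near (phi : X' -> R) : continuous phi -> bounded_fun phi ->
  (fun nu : M => \int[nu]_x phi x) @ F --> \int[mu]_x phi x.
Proof.
move=> cphi [m [_ bphi]].
pose k := Num.max m 0 + 1.
have mk : m < k by rewrite ltr_pwDr// le_max lexx.
have k0 : 0 < k by rewrite ltr_pwDr// le_max lexx orbT.
have phik x : `|phi x| <= k by exact: bphi.
have ck : continuous (fun _ : X' => k) by exact: cst_continuous.
have cpk : continuous (fun x : X' => phi x + k).
  by move=> x; exact: (continuousD (cphi x) (ck x)).
have pk2 x : 0 <= phi x + k <= 2 * k.
  by have := phik x; rewrite ler_norml => /andP[h1 h2]; apply/andP; split; lra.
have k20 : 0 < 2 * k by lra.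
have kk (x : X') : 0 <= k <= k by rewrite lexx ltW.
have intE (nu : M) : \int[nu]_x phi x = \int[nu]_x (phi x + k) - \int[nu]_x k.
  have nuT : (nu setT < +oo)%E by rewrite ltey_eq fin_num_measure.
  have ik : nu.-integrable setT (EFin \o (fun=> k)).
    by apply: finite_measure_integrable_cst.
  have ipk : nu.-integrable setT (EFin \o (fun x => phi x + k)).
    apply: measurable_bounded_integrable => //.
      exact: (continuous_borel_real cpk).
    exists (2 * k); split; first exact: num_real.
    move=> K /ltW kK x _ /=; apply: le_trans kK.
    by have /andP[p0 pk] := pk2 x; rewrite ger0_norm.
  rewrite -RintegralB//; apply: eq_Rintegral => x _.
  by rewrite addrK.
rewrite intE; under eq_fun do rewrite intE.
by apply: cvgB; [exact: narrow_near_ge0 cpk pk2 k20|exact: narrow_near_ge0 ck kk k0].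
Qed.

End near.

Lemma HK_openP (U : set M) : HK_open d U <->
  forall mu, U mu -> exists2 e : R, 0 < e & [set nu | (HK d mu nu < e%:E)%E] `<=` U.
Proof. by []. Qed.

(** The narrow topology is generated by the evaluations at test functions, thus
convergence in it can be tested on integrals, both for the filter of narrow
neighbourhoods and for the filter of [HK]-balls. *)
Lemma HK_open_narrow (U : set M) : HK_open d U <-> narrow_open d U.
Proof.
split.
  move=> /HK_openP oU; rewrite /narrow_open openE => mu Umu.
  have [e e0 eU] := oU _ Umu; rewrite /interior.
  apply: filterS eU _.
  apply: (HK_near dm s_dense (FF := @nbhs_filter (narrow_space d) mu) _ e0).
  move=> phi cphi bphi.
  pose f : narrow_space d -> {ptws Cb d -> R} :=
    fun nu : M => (fun phi : Cb d => \int[nu]_x sval phi x).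
  have cf : f @ nbhs mu --> f mu by exact: initial_continuous.
  have Ff : Filter (f @ nbhs mu).
    by apply: fmap_filter; exact: (@nbhs_filter (narrow_space d) mu).
  exact: ((ptws_cvgP _ Ff).1 cf (exist _ phi (conj cphi bphi))).
move=> [V oV VU]; apply/HK_openP => mu Umu.
pose F : set_system M := [set A | exists2 e : R, 0 < e &
  [set nu | (HK d mu nu < e%:E)%E] `<=` A].
have FF : Filter F.
  split.
  - by exists 1.
  - move=> A B [e e0 eA] [f f0 fB]; exists (Num.min e f).
      by rewrite lt_min e0.
    move=> nu /=; rewrite EFin_min lt_min => /andP[he hf].
    by split; [exact: eA|exact: fB].
  - by move=> A B AB [e e0 eA]; exists e => //; exact: subset_trans AB.
suff : F U by [].
rewrite -VU.
pose f : M -> {ptws Cb d -> R} := fun nu => (fun phi => \int[nu]_x sval phi x).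
have Ff : Filter (f @ F) by exact: fmap_filter.
suff : f @ F --> f mu.
  apply; apply: open_nbhs_nbhs; split => //.
  by move: Umu; rewrite -VU.
apply: (ptws_cvgP _ Ff).2 => -[phi [cphi bphi]].
by apply: (narrow_near (F := F)) => // e e0; exists e.
Qed.

Lemma HK_cvg0P (mu_ : nat -> M) (mu : M) :
  HK d (mu_ n) mu @[n --> \oo] --> (0 : \bar R)%E <->
  forall e : R, 0 < e -> \forall n \near \oo, (HK d mu (mu_ n) < e%:E)%E.
Proof.
split=> [h e e0|h].
  have : \forall n \near \oo, (HK d (mu_ n) mu < e%:E)%E.
    apply: (h [set y | (y < e%:E)%E]); apply: open_nbhs_nbhs.
    by split; [exact: open_ereal_lt_ereal|rewrite /= lte_fin].
  by apply: filterS => n; exact: (HK_sym dm s_dense e0).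
move=> W W0; have /nbhs_ballP[e /= e0 eW] : nbhs (0 : R) [set r | W r%:E].
  exact: W0.
apply: filterS (h _ e0) => n /(HK_sym dm s_dense e0) /=.
have : (0 <= HK d (mu_ n) mu)%E by exact: sqrte_ge0.
case: (HK d (mu_ n) mu) => [r| |]//; rewrite lee_fin lte_fin => r0 re.
by apply: eW; rewrite /ball/= sub0r normrN ger0_norm.
Qed.

Lemma HK_cvg_narrow (mu_ : nat -> M) (mu : M) :
  HK d (mu_ n) mu @[n --> \oo] --> (0 : \bar R)%E <->
  (forall phi : X' -> R, continuous phi -> bounded_fun phi ->
    \int[mu_ n]_x phi x @[n --> \oo] --> \int[mu]_x phi x).
Proof.
rewrite HK_cvg0P; split => h.
  move=> phi cphi bphi.
  exact: (narrow_near (F := mu_ @ \oo) h cphi bphi).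
move=> e e0.
exact: (HK_near dm s_dense (F := mu_ @ \oo) h e0).
Qed.

End topologies.

Theorem theorem7p15 (R : realType) (X : pointedType) (d : X -> X -> \bar R)
    (d_metric : extended_metric d) (X_separable : separable_space (dspace d)) :
  [/\ forall U : set (radon_measure R (dspace d)),
        HK_open d U <-> narrow_open d U,
      forall (mu_ : nat -> radon_measure R (dspace d))
          (mu : radon_measure R (dspace d)),
        HK d (mu_ n) mu @[n --> \oo] --> (0 : \bar R)%E <->
        (forall phi : dspace d -> R, continuous phi -> bounded_fun phi ->
          \int[mu_ n]_x phi x @[n --> \oo] --> \int[mu]_x phi x)
    & exists2 D : set (radon_measure R (dspace d)), countable D &
        forall (mu : radon_measure R (dspace d)) (e : R), 0 < e ->
          exists2 nu, D nu & (HK d mu nu < e%:E)%E].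
Proof.
have [s s_dense] := separable_sequence d_metric X_separable.
split.
- exact: (HK_open_narrow d_metric s_dense).
- exact: (HK_cvg_narrow d_metric s_dense).
- exact: (HK_separable d_metric s_dense).
Qed.
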